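(* Let $\Bbbk$ be a field of characteristic $p>0$ and let $U$ be the Hopf algebra over $\Bbbk$ defined in the context. Let $H$ be any Hopf algebra over $\Bbbk$ containing $U$ as a Hopf subalgebra. If $H$ acts inner-faithfully and homogeneously on a noetherian Koszul Artin-Schelter regular $\Bbbk$-algebra $T$ of global dimension two, then $T$ is isomorphic to the commutative polynomial ring $\Bbbk[x_1,x_2]$.
   Context: $U$ is the $\Bbbk$-algebra generated by $u$ and $w$ subject to $u^p=0$, $w^p=w$, $wu-uw=u$. It is a Hopf algebra of dimension $p^2$ with $u$ and $w$ primitive: $\Delta(u)=u\otimes 1+1\otimes u$, $\Delta(w)=w\otimes 1+1\otimes w$, $\varepsilon(u)=\varepsilon(w)=0$, $S(u)=-u$, $S(w)=-w$. A connected graded $\Bbbk$-algebra $T=\bigoplus_{n\geq 0}T_n$ ($T_0=\Bbbk$) is Artin-Schelter (AS) regular of dimension $d$ if: (a) $T$ has global dimension $d<\infty$; (b) $\mathrm{Ext}^i_T({}_T\Bbbk,{}_TT)=\mathrm{Ext}^i_T(\Bbbk_T,T_T)=0$ for all $i\neq d$, where $\Bbbk=T/T_{\geq 1}$; (c) $\mathrm{Ext}^d_T({}_T\Bbbk,{}_TT)\cong\mathrm{Ext}^d_T(\Bbbk_T,T_T)\cong\Bbbk(l)$ (a degree shift of $\Bbbk$) for some integer $l$; (d) $T$ has finite Gelfand-Kirillov dimension. An action of a Hopf algebra $H$ on an algebra $T$ means that $T$ is a left $H$-module algebra. It is inner-faithful if there is no nonzero Hopf ideal $I\subseteq H$ with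 $IT=0$, and homogeneous if each graded piece $T_n$ is a left $H$-submodule of $T$. *)

(* Defs.v *)
From HB Require Import structures.
From mathcomp Require Import all_boot all_order all_algebra.
From mathcomp Require Import boolp classical_sets functions reals ereal.
From mathcomp Require Import topology normedtype sequences exp.
From mathcomp Require Import Rstruct.

Set Implicit Arguments.
Unset Strict Implicit.
Unset Printing Implicit Defensive.

Import GRing.Theory.

Local Open Scope classical_set_scope.
Local Open Scope ring_scope.

Section Tensors.
Variable k : fieldType.

(* A formal sum x_1 (x) y_1 + ... + x_n (x) y_n of pure tensors is written as
   the sequence of the pairs (x_i, y_i).  By the universal property of the
   tensor product, two formal sums denote the same tensor iff every bilinear
   map takes the same value on both; likewise for triple tensors. *)

Definition bilinear_map (V W Z : lmodType k) (b : V -> W -> Z) : Prop :=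
  (forall v, linear (b v)) /\ (forall w, linear (fun v => b v w)).

Definition trilinear_map (V W X Z : lmodType k) (b : V -> W -> X -> Z) : Prop :=
  [/\ forall v w, linear (b v w),
      forall v x, linear (fun w => b v w x) &
      forall w x, linear (fun v => b v w x)].

Definition tensor_eq (V W : lmodType k) (s t : seq (V * W)) : Prop :=
  forall (Z : lmodType k) (b : V -> W -> Z), bilinear_map b ->
    \sum_(x <- s) b x.1 x.2 = \sum_(x <- t) b x.1 x.2.

Definition tensor3_eq (V W X : lmodType k) (s t : seq (V * W * X)) : Prop :=
  forall (Z : lmodType k) (b : V -> W -> X -> Z), trilinear_map b ->
    \sum_(x <- s) b x.1.1 x.1.2 x.2 = \sum_(x <- t) b x.1.1 x.1.2 x.2.

Definition tensor_scale (V W : lmodType k) (c : k) (s : seq (V * W)) :=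
  [seq (c *: x.1, x.2) | x <- s].

Definition tensor_mul (A B : algType k) (s t : seq (A * B)) :=
  [seq (x.1 * y.1, x.2 * y.2) | x <- s, y <- t].

Definition tensor_map (V W V' W' : lmodType k) (f : V -> V') (g : W -> W')
    (s : seq (V * W)) :=
  [seq (f x.1, g x.2) | x <- s].

End Tensors.

(* [comul x] is a formal sum representing the tensor Delta(x); all axioms on
   it are imposed up to equality of tensors. *)
Record hopfAlgType (k : fieldType) := HopfAlgebra {
  hopf_sort :> algType k;
  comul : hopf_sort -> seq (hopf_sort * hopf_sort);
  counit : {lrmorphism hopf_sort -> k^o};
  antipode : {linear hopf_sort -> hopf_sort};
  comul_linear : forall (c : k) (x y : hopf_sort),
    tensor_eq (comul (c *: x + y)) (tensor_scale c (comul x) ++ comul y);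
  comul1 : tensor_eq (comul 1) [:: (1, 1)];
  comulM : forall x y : hopf_sort,
    tensor_eq (comul (x * y)) (tensor_mul (comul x) (comul y));
  comulA : forall x : hopf_sort,
    tensor3_eq [seq (z.1, z.2, y.2) | y <- comul x, z <- comul y.1]
               [seq (y.1, z.1, z.2) | y <- comul x, z <- comul y.2];
  counitl : forall x : hopf_sort,
    \sum_(y <- comul x) (counit y.1 : k) *: y.2 = x;
  counitr : forall x : hopf_sort,
    \sum_(y <- comul x) (counit y.2 : k) *: y.1 = x;
  antipodel : forall x : hopf_sort,
    \sum_(y <- comul x) antipode y.1 * y.2 = (counit x : k)%:A;
  antipoder : forall x : hopf_sort,
    \sum_(y <- comul x) y.1 * antipode y.2 = (counit x : k)%:A
}.
Arguments comul {k h} x.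
Arguments counit {k h}.
Arguments antipode {k h}.

Section HopfAlgebras.
Variable k : fieldType.
Notation hopfAlgType := (hopfAlgType k).

Definition primitive (H : hopfAlgType) (x : H) : Prop :=
  tensor_eq (comul x) [:: (x, 1); (1, x)].

Definition hopf_morphism (H K : hopfAlgType) (f : {lrmorphism H -> K}) : Prop :=
  [/\ forall x, tensor_eq (comul (f x)) (tensor_map f f (comul x)),
      forall x, counit (f x) = counit x &
      forall x, antipode (f x) = f (antipode x)].

(* The condition on [comul] says Delta(I) is contained in I (x) H + H (x) I. *)
Definition hopf_ideal (H : hopfAlgType) (I : set H) : Prop :=
  [/\ I 0 /\ (forall (c : k) x y, I x -> I y -> I (c *: x + y)),
      forall h x, I x -> I (h * x) /\ I (x * h),
      forall x, I x -> exists2 s : seq (H * H), tensor_eq (comul x) s &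
        forall y, y \in s -> I y.1 \/ I y.2,
      forall x, I x -> counit x = 0 &
      forall x, I x -> I (antipode x)].

Record module_algebra_action (H : hopfAlgType) (T : algType k)
    (act : H -> T -> T) : Prop := ModuleAlgebraAction {
  act_linearl : forall t, linear (fun h => act h t);
  act_linearr : forall h, linear (act h);
  act1 : forall t, act 1 t = t;
  actM : forall g h t, act (g * h) t = act g (act h t);
  act_one : forall h, act h 1 = (counit h : k)%:A;
  act_mul : forall h a b,
    act h (a * b) = \sum_(y <- comul h) act y.1 a * act y.2 b
}.

Definition inner_faithful (H : hopfAlgType) (T : algType k)
    (act : H -> T -> T) : Prop :=
  forall I : set H, hopf_ideal I -> (forall h t, I h -> act h t = 0) ->
    I = [set 0].

Definition U_relations (p : nat) (A : algType k) (u w : A) : Prop :=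
  [/\ u ^+ p = 0, w ^+ p = w & w * u - u * w = u].

(* [U] is the algebra presented by the generators u, w and the relations
   [U_relations], expressed by the universal property of the presentation. *)
Definition is_U (p : nat) (U : hopfAlgType) (u w : U) : Prop :=
  [/\ U_relations p u w,
      forall (A : algType k) (a b : A), U_relations p a b ->
        exists f : {lrmorphism U -> A}, [/\ f u = a, f w = b &
          forall g : {lrmorphism U -> A}, g u = a -> g w = b -> g =1 f],
      primitive u /\ primitive w,
      counit u = 0 /\ counit w = 0 &
      antipode u = - u /\ antipode w = - w].

End HopfAlgebras.

(* The family [A] of subsets of [V], each assumed to be a subgroup, is a direct
   sum decomposition of [V]. *)
Definition direct_sum (I : eqType) (V : zmodType) (A : I -> set V) : Prop :=
  (forall x, exists (s : seq I) (f : I -> V),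
     [/\ uniq s, forall i, A i (f i) & x = \sum_(i <- s) f i]) /\
  (forall (s : seq I) (f : I -> V), uniq s -> (forall i, A i (f i)) ->
     \sum_(i <- s) f i = 0 -> forall i, i \in s -> f i = 0).

Record cgAlgType (k : fieldType) := ConnectedGraded {
  cg_sort :> algType k;
  cg_deg : nat -> set cg_sort;
  cg_deg_sub : forall n, cg_deg n 0 /\
    (forall (c : k) x y, cg_deg n x -> cg_deg n y -> cg_deg n (c *: x + y));
  cg_deg_direct : direct_sum cg_deg;
  cg_degM : forall m n x y, cg_deg m x -> cg_deg n y -> cg_deg (m + n) (x * y);
  cg_deg0 : forall x, cg_deg 0 x <-> exists c : k, x = c%:A
}.
Arguments cg_deg {k c} n x.

Section ConnectedGraded.
Variable k : fieldType.
Notation cgAlgType := (cgAlgType k).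

Definition cg_plus (T : cgAlgType) : set T :=
  [set x | exists (n : nat) (f : nat -> T),
     (forall i, cg_deg i.+1 (f i)) /\ x = \sum_(i < n) f i].

Definition cg_aug (T : cgAlgType) (t : T) : k :=
  xget 0 [set c : k | cg_plus (t - c%:A)].

Section Augmentation.
Variable T : cgAlgType.

Lemma cg_deg_1 : cg_deg 0 (1 : T).
Proof. by apply/cg_deg0; exists 1; rewrite scale1r. Qed.

Lemma cg_plus_deg n (x : T) : cg_deg n.+1 x -> cg_plus x.
Proof.
move=> hx; exists n.+1, (fun i => if i == n then x else 0); split.
  by move=> i; case: eqP => [->//|_]; case: (cg_deg_sub T i.+1).
rewrite big_ord_recr /= eqxx big1 ?add0r // => i _.
by rewrite ltn_eqF.
Qed.

Lemma cg_plus0 : cg_plus (0 : T).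
Proof. by apply: (@cg_plus_deg 0); case: (cg_deg_sub T 1). Qed.

Lemma cg_plus_lin (c : k) (x y : T) :
  cg_plus x -> cg_plus y -> cg_plus (c *: x + y).
Proof.
move=> [n [f [hf ->]]] [m [g [hg ->]]].
exists (n + m)%N, (fun i => c *: (if (i < n)%N then f i else 0)
                       + (if (i < m)%N then g i else 0)); split.
  move=> i; have [h0 h] := cg_deg_sub T i.+1.
  by apply: h; case: ifP.
rewrite big_split /= -scaler_sumr -!big_mkcond /=; congr (c *: _ + _).
  by rewrite [RHS](big_ord_narrow (leq_addr m n)).
by rewrite [RHS](big_ord_narrow (leq_addl n m)).
Qed.

Lemma cg_plus_sum (I : Type) (s : seq I) (f : I -> T) :
  (forall i, cg_plus (f i)) -> cg_plus (\sum_(i <- s) f i).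
Proof.
move=> hf; elim: s => [|i s ih]; first by rewrite big_nil; apply: cg_plus0.
by rewrite big_cons -[f i]scale1r; apply: cg_plus_lin.
Qed.

Lemma cg_plus_mull (x y : T) : cg_plus y -> cg_plus (x * y).
Proof.
move=> [n [g [hg ->]]]; rewrite mulr_sumr; apply: cg_plus_sum => j.
have [s [f [_ hf ->]]] := (cg_deg_direct T).1 x.
rewrite mulr_suml; apply: cg_plus_sum => i.
by apply: (@cg_plus_deg (i + j)%N); rewrite -addnS; apply: cg_degM.
Qed.

Lemma cg_plus_unique (c : k) : cg_plus (c%:A : T) -> c = 0.
Proof.
move=> [n [f [hf e]]].
have h0 i : cg_deg i (if i is j.+1 then f j else - (c%:A) : T).
  case: i => [|i]; last exact: hf.
  by apply/cg_deg0; exists (- c); rewrite scaleNr.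
have := (cg_deg_direct T).2 (iota 0 n.+1) _ (iota_uniq _ _) h0.
rewrite -[n.+1]/(n.+1 - 0)%N -/(index_iota 0 n.+1) big_mkord.
rewrite big_ord_recl /= e addNr => /(_ erefl 0%N).
rewrite mem_index_iota => /(_ isT) /eqP.
by rewrite -e oppr_eq0 scaler_eq0 oner_eq0 orbF => /eqP.
Qed.

Lemma cg_augP (t : T) : cg_plus (t - (cg_aug t)%:A).
Proof.
suff h : exists c : k, cg_plus (t - c%:A).
  by case: h => c hc; exact: (@xgetI k 0 [set c : k | cg_plus (t - c%:A)] c hc).
have [s [f [_ hf ->]]] := (cg_deg_direct T).1 t.
elim: s => [|i s [c ih]].
  by exists 0; rewrite big_nil scale0r subr0; apply: cg_plus0.
case: i (hf i) => [/cg_deg0 [b eb]|i hi]; last first.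
  exists c; rewrite big_cons -addrA -[X in X + _]scale1r.
  exact: cg_plus_lin (cg_plus_deg hi) ih.
exists (b + c); rewrite big_cons eb scalerDl opprD addrACA subrr add0r.
exact: ih.
Qed.

Lemma cg_augE (t : T) (c : k) : cg_plus (t - c%:A) -> cg_aug t = c.
Proof.
move=> hc; apply/eqP; rewrite -subr_eq0; apply/eqP/cg_plus_unique.
have := cg_plus_lin (-1) (cg_augP t) hc.
by rewrite scaleN1r opprB scalerBl addrA subrK.
Qed.

Lemma cg_augD : {morph @cg_aug T : x y / x + y}.
Proof.
move=> x y; apply: cg_augE.
have := cg_plus_lin 1 (cg_augP x) (cg_augP y).
by rewrite scale1r scalerDl opprD addrACA.
Qed.

Lemma cg_aug1 : cg_aug (1 : T) = 1.
Proof. by apply: cg_augE; rewrite scale1r subrr; apply: cg_plus0. Qed.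

Lemma cg_augM : {morph @cg_aug T : x y / x * y}.
Proof.
move=> x y; apply: cg_augE.
have := cg_plus_lin (cg_aug y) (cg_augP x) (cg_plus_mull x (cg_augP y)).
rewrite mulrBr -scalerAr mulr1 scalerBr scalerA [cg_aug y * _]mulrC.
by rewrite addrC addrA subrK.
Qed.

End Augmentation.

(* The trivial module k = T / T_{>=1}. *)
Definition trivial_module (T : cgAlgType) : Type := k.
HB.instance Definition _ (T : cgAlgType) := GRing.Zmodule.on (trivial_module T).

Section TrivialModule.
Variable T : cgAlgType.
Let scale (t : T) (a : trivial_module T) : trivial_module T :=
  cg_aug t * (a : k).

Let scaleA a b v : scale a (scale b v) = scale (a * b) v.
Proof. by rewrite /scale mulrA -cg_augM. Qed.
Let scale1 : left_id 1 scale.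
Proof. by move=> v; rewrite /scale cg_aug1 mul1r. Qed.
Let scaleDr : right_distributive scale +%R.
Proof. by move=> a v w; rewrite /scale mulrDr. Qed.
Let scaleDl v : {morph scale^~ v : a b / a + b}.
Proof. by move=> a b; rewrite /scale cg_augD mulrDl. Qed.

HB.instance Definition _ :=
  GRing.Zmodule_isLmodule.Build T (trivial_module T)
    scaleA scale1 scaleDr scaleDl.
End TrivialModule.

End ConnectedGraded.

(* The opposite algebra: right T-modules are left modules over it. *)
Section OppositeAlgebra.
Variables (k : fieldType) (A : algType k).

Let cscale (a : k) (x : A^c) : A^c := a *: (x : A).
Let cscaleA a b v : cscale a (cscale b v) = cscale (a * b) v.
Proof. exact: scalerA. Qed.
Let cscale1 : left_id 1 cscale. Proof. exact: scale1r. Qed.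
Let cscaleDr : right_distributive cscale +%R. Proof. exact: scalerDr. Qed.
Let cscaleDl v : {morph cscale^~ v : a b / a + b}.
Proof. exact: (scalerDl (v : A)). Qed.
HB.instance Definition _ :=
  GRing.Zmodule_isLmodule.Build k A^c cscaleA cscale1 cscaleDr cscaleDl.

Let cscaleAl (a : k) (x y : A^c) : a *: (x * y) = a *: x * y.
Proof. exact: (@scalerAr k A a y x). Qed.
HB.instance Definition _ := GRing.Lmodule_isLalgebra.Build k A^c cscaleAl.

Let cscaleAr (a : k) (x y : A^c) : a *: (x * y) = x * (a *: y).
Proof. exact: (@scalerAl k A a y x). Qed.
HB.instance Definition _ := GRing.Lalgebra_isAlgebra.Build k A^c cscaleAr.

End OppositeAlgebra.

Section OppositeGraded.
Variables (k : fieldType) (T : cgAlgType k).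

Let op_deg (n : nat) : set T^c := @cg_deg k T n.
Let op_degM m n (x y : T^c) :
  op_deg m x -> op_deg n y -> op_deg (m + n) (x * y).
Proof. by move=> hx hy; rewrite addnC; exact: (@cg_degM k T n m y x hy hx). Qed.

Definition cg_op : cgAlgType k :=
  @ConnectedGraded k T^c op_deg (@cg_deg_sub k T) (@cg_deg_direct k T)
    op_degM (@cg_deg0 k T).
End OppositeGraded.

Section Homological.
Variable R : pzRingType.

Definition projective (P : lmodType R) : Prop :=
  forall (M N : lmodType R) (g : {linear M -> N}) (f : {linear P -> N}),
    (forall y, exists x, g x = y) ->
    exists h : {linear P -> M}, forall x, g (h x) = f x.

Record resolution (M : lmodType R) := Resolution {
  res_mod :> nat -> lmodType R;
  res_d : forall i, {linear res_mod i.+1 -> res_mod i};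
  res_aug : {linear res_mod 0 -> M};
  res_projective : forall i, projective (res_mod i);
  res_aug_surj : forall m, exists x, res_aug x = m;
  res_exact0 : forall x, res_aug x = 0 <-> exists y, res_d 0 y = x;
  res_exact : forall i x, res_d i x = 0 <-> exists y, res_d i.+1 y = x
}.

Definition pd_le (M : lmodType R) (n : nat) : Prop :=
  exists P : resolution M, forall i, (n < i)%N -> forall x : P i, x = 0.

Definition gldim_le (n : nat) : Prop := forall M : lmodType R, pd_le M n.

(* Left global dimension. *)
Definition has_gldim (d : nat) : Prop :=
  gldim_le d /\ forall n, gldim_le n -> (d <= n)%N.

(* Ext^i_R(M, N) is the cohomology at i of Hom_R(P, N), for a projective
   resolution P of M. *)
Section Ext.
Variables (M N : lmodType R) (P : resolution M).

Definition cocycle (i : nat) (f : P i -> N) : Prop :=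
  linear f /\ forall y, f (res_d P i y) = 0.

Definition coboundary (i : nat) : (P i -> N) -> Prop :=
  match i return (P i -> N) -> Prop with
  | 0 => fun f => forall x, f x = 0
  | j.+1 => fun f => exists g : P j -> N,
      linear g /\ forall x, f x = g (res_d P j x)
  end.
End Ext.

Definition ext_vanishes (i : nat) (M N : lmodType R) : Prop :=
  forall (P : resolution M) (f : P i -> N), cocycle f -> coboundary f.

Definition is_basis (M : lmodType R) (B : set M) : Prop :=
  (forall x, exists (s : seq M) (c : M -> R),
     [/\ uniq s, forall b, b \in s -> B b & x = \sum_(b <- s) c b *: b]) /\
  (forall (s : seq M) (c : M -> R), uniq s -> (forall b, b \in s -> B b) ->
     \sum_(b <- s) c b *: b = 0 -> forall b, b \in s -> c b = 0).

Definition left_ideal (I : set R) : Prop :=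
  [/\ I 0, forall x y, I x -> I y -> I (x + y) & forall a x, I x -> I (a * x)].

Definition left_noetherian : Prop :=
  forall I : nat -> set R, (forall n, left_ideal (I n)) ->
    (forall n, I n `<=` I n.+1) ->
    exists N, forall n, (N <= n)%N -> I n = I N.

End Homological.

Definition noetherian (R : pzRingType) : Prop :=
  left_noetherian R /\ left_noetherian R^c.

Section GelfandKirillov.
Variable k : fieldType.

Definition lin_span (V : lmodType k) (s : seq V) : set V :=
  [set v | exists c : nat -> k, v = \sum_(i < size s) c i *: s`_i].

Definition lin_indep (V : lmodType k) (s : seq V) : Prop :=
  forall c : nat -> k, \sum_(i < size s) c i *: s`_i = 0 ->
    forall i, (i < size s)%N -> c i = 0.

(* The dimension of a finite-dimensional subspace. *)
Definition subspace_dim (V : lmodType k) (A : set V) : nat :=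
  xget 0%N [set n | exists b : seq V,
    [/\ size b = n, lin_indep b & A = lin_span b]].

Fixpoint powers (A : algType k) (s : seq A) (n : nat) : seq A :=
  if n is m.+1 then [seq x * y | x <- s, y <- powers s m] else [:: 1].

(* The supremum over the finite-dimensional subspaces V containing 1, with V
   spanned by 1 :: s, of limsup_n (log (dim V^n) / log n). *)
Definition GKdim (A : algType k) : \bar Rdefinitions.R :=
  ereal_sup [set limn_esup (fun n =>
    (ln (subspace_dim (lin_span (powers (1 :: s) n)))%:R / ln n%:R)%:E)
    | s in [set: seq A]].

End GelfandKirillov.

Section ASRegular.
Variable k : fieldType.

(* Z-graded left modules. *)
Record module_grading (T : cgAlgType k) (M : lmodType T)
    (gr : int -> set M) : Prop := ModuleGrading {
  gr_sub : forall n, gr n 0 /\ (forall x y, gr n x -> gr n y -> gr n (x - y));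
  gr_direct : direct_sum gr;
  gr_scale : forall (i : nat) (n : int) (t : T) (x : M),
    cg_deg i t -> gr n x -> gr (i%:Z + n) (t *: x)
}.

(* A resolution of the trivial module, itself in degree 0, by graded modules
   and maps of degree 0. *)
Record graded_resolution (T : cgAlgType k) (P : resolution (trivial_module T))
    (gr : forall i, int -> set (P i)) : Prop := GradedResolution {
  gres_mod : forall i, module_grading (@gr i);
  gres_d : forall i n x, gr i.+1 n x -> gr i n (res_d P i x);
  gres_aug : forall n x, gr 0%N n x -> n != 0 -> res_aug P x = 0
}.

Definition cg_degz (T : cgAlgType k) (n : int) : set T :=
  if n is Posz m then @cg_deg k T m else [set 0].

Definition homogeneous_map (T : cgAlgType k) (M : lmodType T)
    (gr : int -> set M) (j : int) (f : M -> T) : Prop :=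
  forall n x, gr n x -> cg_degz (n + j) (f x).

(* Ext^d_T(k, T) is isomorphic to k(l) as a graded right T-module: [ev] maps
   the cocycles onto k, its kernel consists of the coboundaries, and it is
   concentrated in degree -l, where k(l)_j = k_{l+j}. *)
Definition ext_is_shifted_k (T : cgAlgType k) (d : nat) (l : int) : Prop :=
  forall (P : resolution (trivial_module T)) (gr : forall i, int -> set (P i)),
    graded_resolution gr ->
    exists ev : (P d -> T^o) -> k,
      [/\ forall f g : P d -> T^o, cocycle f -> cocycle g ->
            ev (f \+ g) = ev f + ev g,
          forall (f : P d -> T^o) (t : T), cocycle f ->
            ev (fun x => (f x : T) * t) = ev f * cg_aug t,
          forall f : P d -> T^o, cocycle f -> (ev f = 0 <-> coboundary f),
          forall (f : P d -> T^o) j, cocycle f ->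
            homogeneous_map (gr d) j f -> j != - l -> ev f = 0 &
          exists f : P d -> T^o,
            [/\ cocycle f, homogeneous_map (gr d) (- l) f & ev f = 1]].

Record AS_regular (T : cgAlgType k) (d : nat) : Prop := ASRegular {
  AS_gldim : has_gldim T d /\ has_gldim (cg_op T) d;
  AS_ext_vanishes : forall i, i <> d ->
    ext_vanishes i (trivial_module T) T^o /\
    ext_vanishes i (trivial_module (cg_op T)) (cg_op T)^o;
  AS_ext_top : exists l : int,
    ext_is_shifted_k T d l /\ ext_is_shifted_k (cg_op T) d l;
  AS_GKdim : (GKdim T < +oo)%E
}.

(* k has a linear free resolution: the i-th term has a basis of elements of
   degree i. *)
Definition koszul (T : cgAlgType k) : Prop :=
  exists (P : resolution (trivial_module T)) (gr : forall i, int -> set (P i)),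
    graded_resolution gr /\
    forall i : nat, exists2 B : set (P i), is_basis B & B `<=` gr i i%:Z.

Definition homogeneous_action (H : hopfAlgType k) (T : cgAlgType k)
    (act : H -> T -> T) : Prop :=
  forall n h t, cg_deg n t -> cg_deg n (act h t).

End ASRegular.

(* Main.v *)
Require Import Defs.
From HB Require Import structures.
From mathcomp Require Import all_boot all_order all_algebra.
From mathcomp Require Import boolp classical_sets.
From mathcomp Require Import -(notations) mpoly.

Set Implicit Arguments.
Unset Strict Implicit.
Unset Printing Implicit Defensive.
Import GRing.Theory.
Local Open Scope classical_set_scope.
Local Open Scope ring_scope.

(** The algebra T turns out to be a quadratic algebra on two generators with
    a single relation, and the action of the two-dimensional solvable algebra
    spanned by u and w leaves only one possible relation, the commutator.

    Shape of T.  A linear graded free resolution P of k is minimal: the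
    coefficients of the differentials lie in T_+.  A projective resolution of
    length two is homotopy equivalent to P; the homotopy gives d_3 = E d_3 for
    an endomorphism E of P_2 with values in T_+ P_2, so that d_3 = 0 by the
    graded Nakayama argument ([res_d_eq0]).  Hence every linear map P_2 -> T is a
    cocycle; as coboundaries take values in T_+, the one-dimensionality of
    Ext^2(k, T) forces P_2 to have rank one ([B2_singleton]).  Let d_2 send its
    generator to the sum of the l_j b_j.  A linear relation between the l_j
    yields a cocycle P_1 -> T with scalar values on the basis, which is a
    coboundary because Ext^1(k, T) = 0, hence zero: so the l_j are linearly
    independent, and every basis element of P_1 occurs among the b_j.  With
    x_j = d_1(b_j), this says that T is generated by the n elements x_j of a
    basis of T_1, and that the left syzygies of (x_j) are the multiples of
    (l_j) ([linear_resolution_presentation]).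

    Number of generators.  Nondegeneracy of the relation makes nonzero elements
    of T_1 right regular ([qp_regular]).  If n > 2, it makes the sum
    T x_0 + T x_1 direct as well, and the left ideals spanned by the first
    elements x_0 x_1^j form a strictly increasing sequence, which contradicts
    noetherianity ([noetherian_quadratic_leq2]).

    The action.  As u is primitive, the ideal H u H is a Hopf ideal; if u killed
    T_1 it would kill T, and u = 0 by inner-faithfulness, against the existence
    of a representation of U on k^2 where u is not zero.  So u acts on T_1 by a
    nonzero nilpotent map, and there are y and x = u y != 0 with u x = 0; in
    particular n = 2.  After adding a multiple of x to y, w acts diagonally, with
    weight a on y and a + 1 on x, by w u - u w = u.  The line spanned by the
    relation of T is stable under u and w.  Stability under u leaves
    alpha x x + beta (x y - y x); the two terms have the distinct weights 2a + 2
    and 2a + 1, so that only one of them occurs, and x x is degenerate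
    ([derivations_commute]).

    Conclusion.  Once x y = y x, the syzygies show that the monomials y^j x^i
    are linearly independent, and T is a polynomial ring
    ([commuting_presentation_iso]). *)

(** * Components in a direct sum *)
Lemma big_uniq_extend (I : eqType) (V : nmodType) (s t : seq I) (f : I -> V) :
  uniq s -> uniq t -> {subset s <= t} ->
  \sum_(i <- s) f i = \sum_(i <- t) (if i \in s then f i else 0).
Proof.
move=> us ut st; rewrite -big_mkcond /= -[RHS]big_filter; apply: perm_big.
apply: uniq_perm => //; first exact: filter_uniq.
by move=> i; rewrite mem_filter; case: (boolP (i \in s)) => //= /st ->.
Qed.

Section Components.
Variables (I : eqType) (V : zmodType) (A : I -> set V).
Hypothesis A_sub :
  forall i, A i 0 /\ (forall x y, A i x -> A i y -> A i (x - y)).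
Hypothesis A_sum : direct_sum A.

(** [v] is the component of [x] of index [i].  As a relation, this is visibly
    compatible with subtraction, from which uniqueness and additivity follow. *)
Definition has_component (i : I) (x v : V) : Prop :=
  A i v /\ exists (s : seq I) (f : I -> V),
    [/\ uniq s, i \notin s, forall j, A j (f j) & x = v + \sum_(j <- s) f j].

Definition component (i : I) (x : V) : V := xget 0 (has_component i x).

Lemma has_component_sub i x y v v' :
  has_component i x v -> has_component i y v' -> has_component i (x - y) (v - v').
Proof.
move=> [hv [s [f [us iS hf ->]]]] [hv' [s' [f' [us' iS' hf' ->]]]].
split; first exact: (A_sub i).2.
exists (undup (s ++ s')), (fun j => (if j \in s then f j else 0) -
                                    (if j \in s' then f' j else 0)); split.
- exact: undup_uniq.
- by rewrite mem_undup mem_cat negb_or iS iS'.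
- by move=> j; have [h0 h] := A_sub j; apply: h; case: ifP.
rewrite sumrB -!big_uniq_extend ?undup_uniq //; last 2 first.
- by move=> j js; rewrite mem_undup mem_cat js orbT.
- by move=> j js; rewrite mem_undup mem_cat js.
by rewrite opprD addrACA.
Qed.

Lemma has_component0 i v : has_component i 0 v -> v = 0.
Proof.
move=> [hv [s [f [us iS hf e]]]].
have := A_sum.2 (i :: s) (fun j => if j == i then v else f j).
rewrite /= iS us big_cons eqxx => /(_ isT) h.
have := h _ _ i; rewrite eqxx mem_head; apply=> //.
  by move=> j; case: eqP => [->|].
rewrite [RHS]e; congr (_ + _); rewrite [LHS]big_seq [RHS]big_seq.
by apply: eq_bigr => j js; case: eqP => // ji; rewrite -ji js in iS.
Qed.

Lemma has_component_unique i x v v' :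
  has_component i x v -> has_component i x v' -> v = v'.
Proof.
move=> h /(has_component_sub h); rewrite subrr => /has_component0/eqP.
by rewrite subr_eq0 => /eqP.
Qed.

Lemma has_component_sum i (s : seq I) (f : I -> V) :
  uniq s -> (forall j, A j (f j)) ->
  has_component i (\sum_(j <- s) f j) (if i \in s then f i else 0).
Proof.
move=> us hf; split; first by case: ifP => // _; case: (A_sub i).
case: ifP => iS; last by exists s, f; split; rewrite ?iS ?add0r.
exists (rem i s), f; split => //; first exact: rem_uniq.
  by rewrite mem_rem_uniqF.
by rewrite (perm_big _ (perm_to_rem iS)) big_cons.
Qed.

Lemma componentP i x : has_component i x (component i x).
Proof.
have [s [f [us hf ->]]] := A_sum.1 x.
by apply: xgetI; apply: has_component_sum.
Qed.

Lemma componentE i x v : has_component i x v -> component i x = v.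
Proof. exact/has_component_unique/componentP. Qed.

Lemma component_in i x : A i (component i x).
Proof. by case: (componentP i x). Qed.

Lemma component_id i x : A i x -> component i x = x.
Proof.
move=> hx; apply: componentE; split=> //; exists [::], (fun=> 0).
by split=> // [j|]; [case: (A_sub j)|rewrite big_nil addr0].
Qed.

Lemma component_neq i j x : A i x -> i != j -> component j x = 0.
Proof.
move=> hx ij; apply: componentE; split; first by case: (A_sub j).
exists [:: i], (fun l => if l == i then x else 0); split=> //.
- by rewrite mem_seq1 eq_sym.
- by move=> l; case: eqP => [->//|_]; case: (A_sub l).
by rewrite big_seq1 eqxx add0r.
Qed.

Lemma componentB i : {morph component i : x y / x - y}.
Proof.
by move=> x y; apply: componentE; apply: has_component_sub; apply: componentP.
Qed.

Lemma component0 i : component i 0 = 0.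
Proof. by apply: component_id; case: (A_sub i). Qed.

Lemma componentD i : {morph component i : x y / x + y}.
Proof.
move=> x y; rewrite -{1}[y]opprK -(sub0r y) !componentB component0.
by rewrite sub0r opprK.
Qed.

Lemma component_sum (J : Type) (s : seq J) (f : J -> V) i :
  component i (\sum_(j <- s) f j) = \sum_(j <- s) component i (f j).
Proof. exact: (big_morph _ (@componentD i) (component0 i)). Qed.

Lemma sum_components x :
  exists2 s : seq I, uniq s & x = \sum_(i <- s) component i x.
Proof.
have [s [f [us hf e]]] := A_sum.1 x; exists s => //.
rewrite [LHS]e !big_seq; apply: eq_bigr => i iS; rewrite e.
by rewrite (componentE (has_component_sum i us hf)) iS.
Qed.

Lemma components_eq0 x : (forall i, component i x = 0) -> x = 0.
Proof. by move=> h; have [s _ ->] := sum_components x; rewrite big1. Qed.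

End Components.

(** * Free modules *)
Definition linear_of (R : pzRingType) (M N : lmodType R) (f : M -> N)
  (hf : linear f) : {linear M -> N} :=
  HB.pack f (GRing.isLinear.Build R M N *:%R f hf).

Section FreeModules.
Variables (R : pzRingType) (M : lmodType R) (B : set M).
Hypothesis hB : is_basis B.

(** The graph of the linear map that extends [phi] from the basis [B]. *)
Definition ext_rel (N : lmodType R) (phi : M -> N) (x : M) (y : N) : Prop :=
  exists (s : seq M) (c : M -> R), [/\ uniq s, forall b, b \in s -> B b,
    x = \sum_(b <- s) c b *: b & y = \sum_(b <- s) c b *: phi b].

Lemma ext_rel_linear (N : lmodType R) (phi : M -> N) a x y x' y' :
  ext_rel phi x y -> ext_rel phi x' y' ->
  ext_rel phi (a *: x + x') (a *: y + y').
Proof.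
move=> [s [c [us sB -> ->]]] [s' [c' [us' sB' -> ->]]].
exists (undup (s ++ s')), (fun j => a * (if j \in s then c j else 0) +
                                    (if j \in s' then c' j else 0)).
have merge (Z : lmodType R) (g : M -> Z) :
  a *: (\sum_(b <- s) c b *: g b) + \sum_(b <- s') c' b *: g b =
  \sum_(b <- undup (s ++ s')) (a * (if b \in s then c b else 0) +
     (if b \in s' then c' b else 0)) *: g b.
  under [RHS]eq_bigr do rewrite scalerDl -scalerA.
  rewrite big_split /= -scaler_sumr.
  have st : {subset s <= undup (s ++ s')}.
    by move=> j js; rewrite mem_undup mem_cat js.
  have st' : {subset s' <= undup (s ++ s')}.
    by move=> j js; rewrite mem_undup mem_cat js orbT.
  rewrite (big_uniq_extend _ us (undup_uniq _) st).
  rewrite (big_uniq_extend _ us' (undup_uniq _) st').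
  by congr (_ *: _ + _); apply: eq_bigr => b _; case: ifP; rewrite ?scale0r.
split; [exact: undup_uniq | | exact: merge | exact: merge].
by move=> b; rewrite mem_undup mem_cat => /orP[/sB|/sB'].
Qed.

Lemma ext_rel0 (N : lmodType R) (phi : M -> N) y : ext_rel phi 0 y -> y = 0.
Proof.
move=> [s [c [us sB e ->]]]; rewrite big_seq big1 // => b bs.
by rewrite (hB.2 _ _ us sB (esym e)) // scale0r.
Qed.

Lemma linear_extension (N : lmodType R) (phi : M -> N) :
  exists f : {linear M -> N}, forall b, B b -> f b = phi b.
Proof.
have rel_fun x y y' : ext_rel phi x y -> ext_rel phi x y' -> y = y'.
  move=> h h'; have := ext_rel_linear (-1) h h'.
  by rewrite !scaleN1r addNr => /ext_rel0/eqP; rewrite addrC subr_eq0 => /eqP.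
have rel_tot x : ext_rel phi x (xget 0 (ext_rel phi x)).
  have [s [c [us sB e]]] := hB.1 x.
  by apply: xgetI (_ : ext_rel phi x (\sum_(b <- s) c b *: phi b)); exists s, c.
have lin : linear (fun x => xget 0 (ext_rel phi x)).
  by move=> a x y; apply: rel_fun (rel_tot _) (ext_rel_linear _ _ _).
exists (linear_of lin) => b Bb /=.
apply: rel_fun (rel_tot _) _; exists [:: b], (fun=> 1).
by split=> // [c|/=|/=]; rewrite ?big_seq1 ?scale1r // mem_seq1 => /eqP->.
Qed.

(** The coordinate form at [b] of the free module [M]. *)
Definition fcoord (b : M) : {linear M -> R^o} :=
  proj1_sig (cid (linear_extension (fun c => (c == b)%:R : R^o))).

Lemma fcoord_basis b c : B c -> fcoord b c = (c == b)%:R.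
Proof. by rewrite /fcoord; case: cid => f /= h /h. Qed.

Lemma fcoord_sum (s : seq M) (c : M -> R) b : uniq s ->
  (forall b, b \in s -> B b) ->
  fcoord b (\sum_(e <- s) c e *: e) = if b \in s then c b else 0.
Proof.
move=> us sB; rewrite linear_sum big_seq /=.
under eq_bigr => e es do rewrite linearZ_LR /= (fcoord_basis _ (sB _ es)).
rewrite -big_seq; case: ifP => bs.
  rewrite (bigD1_seq b) //= eqxx big1 => [|e /negPf->]; last exact: mulr0.
  by rewrite addr0; exact: mulr1.
rewrite big_seq big1 // => e es; case: eqP => [eb|_]; last exact: mulr0.
by rewrite -eb es in bs.
Qed.

Lemma basis_expansion x : exists s : seq M, [/\ uniq s,
  forall b, b \in s -> B b & x = \sum_(b <- s) (fcoord b x : R) *: b].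
Proof.
have [s [c [us sB e]]] := hB.1 x; exists s; split=> //.
rewrite [LHS]e !big_seq; apply: eq_bigr => b bs.
by rewrite e fcoord_sum // bs.
Qed.

Lemma fcoord_eq0 x : (forall b, B b -> fcoord b x = 0) -> x = 0.
Proof.
move=> h; have [s [us sB ->]] := basis_expansion x.
by rewrite big_seq big1 // => b bs; rewrite h ?scale0r //; apply: sB.
Qed.

End FreeModules.

(** * Projective resolutions and their comparison *)
Section ImageModule.
Variables (R : pzRingType) (M N : lmodType R) (f : {linear M -> N}).

Definition in_image : {pred N} := fun y => `[< exists x, f x = y >].

Lemma in_image_submod : submod_closed in_image.
Proof.
split; first by apply/asboolP; exists 0; rewrite linear0.
move=> a u v /asboolP[x <-] /asboolP[y <-]; apply/asboolP.
by exists (a *: x + y); rewrite linearP.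
Qed.

HB.instance Definition _ := GRing.isSubmodClosed.Build R N in_image in_image_submod.

Record image_module := ImageModule {
  image_val :> N; image_valP : image_val \in in_image }.
HB.instance Definition _ := [isSub for image_val].
HB.instance Definition _ := [Choice of image_module by <:].
HB.instance Definition _ := [SubChoice_isSubLmodule of image_module by <:].
End ImageModule.

(** Projectivity speaks of surjections only; here it is applied to the
    corestriction of [g] to its image. *)
Lemma projective_lift (R : pzRingType) (P M N : lmodType R)
    (g : {linear M -> N}) (f : {linear P -> N}) : projective P ->
  (forall x, exists y, g y = f x) ->
  exists h : {linear P -> M}, forall x, g (h x) = f x.
Proof.
move=> hP fg.
have hg x : g x \in in_image g by apply/asboolP; exists x.
have hf x : f x \in in_image g by exact/asboolP.
pose g' x := ImageModule (hg x); pose f' x := ImageModule (hf x).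
have linf : linear f' by move=> a x y; apply: val_inj; rewrite /= linearP.
have ling : linear g' by move=> a x y; apply: val_inj; rewrite /= linearP.
have [y|h hh] := hP _ _ (linear_of ling) (linear_of linf).
  have /asboolP[x e] := image_valP y; exists x; exact: val_inj.
by exists h => x; have /(congr1 val) := hh x.
Qed.

Section ProjectiveDimension.
Variables (R : pzRingType) (M : lmodType R).

Lemma res_dd (P : resolution M) i (x : P i.+2) :
  res_d P i (res_d P i.+1 x) = 0.
Proof. by apply/res_exact; exists x. Qed.

(** Comparison maps [phi], [psi] and a homotopy from [psi \o phi] to the
    identity, in degree [n].  Only what the next degree needs is recorded, so
    that the induction goes through one degree at a time: the maps respect
    boundaries, and the homotopy identity holds on boundaries, where the term of
    degree [n - 1] vanishes. *)
Lemma comparison (P Q : resolution M) n :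
  exists (phi : {linear P n -> Q n}) (psi : {linear Q n -> P n})
         (h : {linear P n -> P n.+1}),
  [/\ forall y, exists z, res_d Q n z = phi (res_d P n y),
      forall y, exists z, res_d P n z = psi (res_d Q n y) &
      forall y, res_d P n (h (res_d P n y)) =
                res_d P n y - psi (phi (res_d P n y))].
Proof.
elim: n => [|n [phi [psi [h [hphi hpsi hh]]]]].
  have augd (S : resolution M) y : res_aug S (res_d S 0 y) = 0.
    by apply/res_exact0; exists y.
  have [phi hphi] := projective_lift (@res_projective _ _ P 0)
    (fun x => res_aug_surj Q (res_aug P x)).
  have [psi hpsi] := projective_lift (@res_projective _ _ Q 0)
    (fun x => res_aug_surj P (res_aug Q x)).
  have [x|h hh] := @projective_lift _ _ _ _ (res_d P 0)
    (@idfun (P 0) \- (psi \o phi))%R (@res_projective _ _ P 0).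
    by apply/res_exact0; rewrite /= raddfB /= hpsi hphi subrr.
  exists phi, psi, h; split=> [y|y|y]; last exact: hh.
    by apply/res_exact0; rewrite hphi augd.
  by apply/res_exact0; rewrite hpsi augd.
have [phi' hphi'] := @projective_lift _ _ _ _ (res_d Q n)
  (phi \o res_d P n)%FUN (@res_projective _ _ P n.+1) hphi.
have [psi' hpsi'] := @projective_lift _ _ _ _ (res_d P n)
  (psi \o res_d Q n)%FUN (@res_projective _ _ Q n.+1) hpsi.
have [x|h' hh'] := @projective_lift _ _ _ _ (res_d P n.+1)
  (@idfun (P n.+1) \- (psi' \o phi') \- (h \o res_d P n))%R
  (@res_projective _ _ P n.+1).
  apply/res_exact; rewrite /= !raddfB /= hh hpsi' /= hphi' /=.
  by rewrite subrr.
exists phi', psi', h'; split=> [y|y|y].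
- by apply/res_exact; rewrite hphi' /= res_dd linear0.
- by apply/res_exact; rewrite hpsi' /= res_dd linear0.
by rewrite hh' /= res_dd linear0 subr0.
Qed.

(** In the comparison with a resolution that stops at [n], the image of a
    boundary of degree [n] is a boundary, hence zero; so the homotopy splits the
    differential. *)
Lemma pd_le_split n (P : resolution M) : pd_le M n ->
  exists h : {linear P n -> P n.+1},
    forall y, res_d P n (h (res_d P n y)) = res_d P n y.
Proof.
move=> [Q Q0]; have [phi [psi [h [hphi _ hh]]]] := comparison P Q n.
exists h => y; rewrite hh; have [z <-] := hphi y.
have z0 : z = 0 by exact: Q0.
by rewrite z0 (linear0 (res_d Q n)) (linear0 psi) subr0.
Qed.

End ProjectiveDimension.

(** * Connected graded algebras and graded free modules *)
Lemma scale_regular (R : pzRingType) (a : R) (b : R^o) : a *: b = a * b :> R.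
Proof. by []. Qed.

Section GradedAlgebra.
Variables (k : fieldType) (T : cgAlgType k).

Lemma cg_degB n : cg_deg n (0 : T) /\
  (forall x y : T, cg_deg n x -> cg_deg n y -> cg_deg n (x - y)).
Proof.
have [h0 h] := cg_deg_sub T n; split=> // x y hx hy.
by rewrite addrC -scaleN1r; apply: h.
Qed.

Lemma cg_degZ n c (t : T) : cg_deg n t -> cg_deg n (c *: t).
Proof.
by move=> ht; have [h0 h] := cg_deg_sub T n; rewrite -[_ *: _]addr0; apply: h.
Qed.

Lemma cg_deg_sum n (J : Type) (s : seq J) (f : J -> T) :
  (forall j, cg_deg n (f j)) -> cg_deg n (\sum_(j <- s) f j).
Proof.
move=> hf; have [h0 h] := cg_deg_sub T n.
by apply: big_ind => // a b ha; rewrite -[a]scale1r; apply: h.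
Qed.

Definition cg_comp (n : nat) (t : T) : T := component (@cg_deg k T) n t.

Lemma cg_compP n t : cg_deg n (cg_comp n t).
Proof. exact: component_in cg_degB (cg_deg_direct T) _ _. Qed.

Lemma cg_comp_id n t : cg_deg n t -> cg_comp n t = t.
Proof. exact: component_id cg_degB (cg_deg_direct T) _ _. Qed.

Lemma cg_comp_neq m n t : cg_deg m t -> m != n -> cg_comp n t = 0.
Proof. exact: component_neq cg_degB (cg_deg_direct T) _ _ _. Qed.

Lemma cg_compD n : {morph cg_comp n : x y / x + y}.
Proof. exact: componentD cg_degB (cg_deg_direct T) _. Qed.

Lemma cg_comp_sum n (J : Type) (s : seq J) (f : J -> T) :
  cg_comp n (\sum_(j <- s) f j) = \sum_(j <- s) cg_comp n (f j).
Proof. exact: component_sum cg_degB (cg_deg_direct T) _ _ _ _. Qed.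

Lemma cg_comps_eq0 t : (forall n, cg_comp n t = 0) -> t = 0.
Proof. exact: components_eq0 cg_degB (cg_deg_direct T) _. Qed.

Lemma cg_comp_split n t : exists (s : seq nat) (f : nat -> T),
  [/\ n \notin s, forall j, cg_deg j (f j) & t = cg_comp n t + \sum_(j <- s) f j].
Proof.
have [_ [s [f [_ ns hf e]]]] := componentP cg_degB (cg_deg_direct T) n t.
by exists s, f.
Qed.

Lemma cg_compMr m n (x y : T) :
  cg_deg m y -> cg_comp (n + m) (x * y) = cg_comp n x * y.
Proof.
move=> hy; have [s [f [ns hf e]]] := cg_comp_split n x.
rewrite {1}e mulrDl mulr_suml cg_compD cg_comp_sum.
rewrite cg_comp_id; last by apply: cg_degM => //; exact: cg_compP.
rewrite big_seq big1 ?addr0 // => j js.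
apply: (@cg_comp_neq (j + m)); first exact: cg_degM.
by rewrite eqn_add2r; apply: contraNneq ns => <-.
Qed.

Lemma cg_aug_alg c : cg_aug (c%:A : T) = c.
Proof. by apply: cg_augE; rewrite subrr; apply: cg_plus0. Qed.

Lemma cg_aug0 : cg_aug (0 : T) = 0.
Proof. by rewrite -[0 in LHS](scale0r 1) cg_aug_alg. Qed.

Lemma cg_aug_sum (J : Type) (s : seq J) (f : J -> T) :
  cg_aug (\sum_(j <- s) f j) = \sum_(j <- s) cg_aug (f j).
Proof. exact: (big_morph _ (@cg_augD k T) cg_aug0). Qed.

Lemma cg_aug_deg n (t : T) : cg_deg n.+1 t -> cg_aug t = 0.
Proof. by move=> h; apply: cg_augE; rewrite scale0r subr0; exact: cg_plus_deg h. Qed.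

Lemma cg_comp0E t : cg_comp 0 t = (cg_aug t)%:A.
Proof.
have [s [f [ns hf e]]] := cg_comp_split 0 t.
have /cg_deg0[c ec] := cg_compP 0 t.
rewrite {2}e cg_augD ec cg_aug_alg cg_aug_sum big_seq big1 ?addr0 // => j js.
case: j js (hf j) => [js|j _ /cg_aug_deg //].
by rewrite js in ns.
Qed.

(** Elements of degree [n.+1] are treated under the assumption that those of
    degree [n] are settled. *)
Lemma cg_deg_ind (S : set T) : S 1 ->
  (forall c x y, S x -> S y -> S (c *: x + y)) ->
  (forall n x, (forall y, cg_deg n y -> S y) -> cg_deg n.+1 x -> S x) ->
  forall x, S x.
Proof.
move=> S1 Slin Sstep.
have S0 : S 0 by have := Slin (-1) _ _ S1 S1; rewrite scaleN1r addNr.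
have Sdeg n : forall y, cg_deg n y -> S y.
  elim: n => [y /cg_deg0[c ->]|n ih y]; last exact: Sstep ih.
  by rewrite -[_%:A]addr0; apply: Slin.
move=> x; have [s _ ->] := sum_components cg_degB (cg_deg_direct T) x.
elim: s => [|i s ih]; first by rewrite big_nil.
rewrite big_cons -[X in X + _]scale1r; apply: Slin => //.
exact: Sdeg (cg_compP _ _).
Qed.

(** The filtration of [T] by the degree of the lowest component. *)
Definition order_ge (n : nat) (t : T) : Prop :=
  forall m, (m < n)%N -> cg_comp m t = 0.

Lemma order_ge_sum n (J : eqType) (s : seq J) (f : J -> T) :
  (forall j, j \in s -> order_ge n (f j)) -> order_ge n (\sum_(j <- s) f j).
Proof.
by move=> h m mn; rewrite cg_comp_sum big_seq big1 // => j /h; apply.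
Qed.

Lemma order_ge_mul n (x y : T) :
  order_ge n x -> cg_aug y = 0 -> order_ge n.+1 (x * y).
Proof.
move=> hx hy.
have [s _ ex] := sum_components cg_degB (cg_deg_direct T) x.
have [s' _ ey] := sum_components cg_degB (cg_deg_direct T) y.
rewrite ex mulr_suml; apply: order_ge_sum => i iS.
rewrite ey mulr_sumr; apply: order_ge_sum => j jS m mn.
rewrite -/(cg_comp i x) -/(cg_comp j y).
have [iltn|nlei] := ltnP i n; first by rewrite hx // mul0r (cg_comp_id (cg_degB m).1).
case: j jS => [|j] _.
  by rewrite cg_comp0E hy scale0r mulr0 (cg_comp_id (cg_degB m).1).
apply: (@cg_comp_neq (i + j.+1)); first exact: cg_degM (cg_compP _ _) (cg_compP _ _).
rewrite neq_ltn addnS; apply/orP; right.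
by rewrite (leq_trans mn) // ltnS (leq_trans nlei) // leq_addr.
Qed.

Lemma order_ge_eq0 (t : T) : (forall n, order_ge n t) -> t = 0.
Proof. by move=> h; apply: cg_comps_eq0 => n; apply: (h n.+1). Qed.

End GradedAlgebra.

Section GradedModule.
Variables (k : fieldType) (T : cgAlgType k) (M : lmodType T) (gr : int -> set M).
Hypothesis hgr : module_grading gr.
Variables (B : set M) (i : int).
Hypotheses (hB : is_basis B) (B_deg : B `<=` gr i).

(** Projecting an expansion of [x] on the basis to the degree of [x] replaces
    each coefficient by its component of degree [n]; coordinates being unique,
    they are equal to these components. *)
Lemma homogeneous_coord (n : nat) (x : M) (b : M) :
  gr (n%:Z + i) x -> cg_deg n (fcoord hB b x : T).
Proof.
move=> hx; have [s [us sB e]] := basis_expansion hB x.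
have gs := gr_sub hgr; have gd := gr_direct hgr.
have e' : x = \sum_(b <- s) cg_comp n (fcoord hB b x : T) *: b.
  rewrite -[LHS](component_id gs gd hx) {1}e (component_sum gs gd).
  rewrite !big_seq; apply: eq_bigr => c cs; have gc := B_deg (sB c cs).
  have [s' [f [ns hf ec]]] := cg_comp_split n (fcoord hB c x : T).
  rewrite {1}ec scalerDl scaler_suml (componentD gs gd) (component_sum gs gd).
  rewrite (component_id gs gd (gr_scale hgr (cg_compP n _) gc)).
  rewrite big_seq big1 ?addr0 // => j js.
  apply: (component_neq gs gd (gr_scale hgr (hf j) gc)).
  by rewrite (inj_eq (addIr i)); apply: contraNneq ns => -[<-].
rewrite e' fcoord_sum //; case: ifP => _; first exact: cg_compP.
exact: (cg_degB T n).1.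
Qed.

End GradedModule.

(** * One-relator quadratic presentations from linear resolutions *)

(** The relation of [T] is the sum of the [l i * x i], read in the tensor
    square of [T_1].  That it generates all relations is expressed by exactness
    of [T -> T^n -> T] at the middle term, where the two maps are given by [l]
    and by [x]; [qp_free] is the nondegeneracy of the relation. *)
Record quadratic_presentation (k : fieldType) (T : cgAlgType k) (n : nat)
    (x l : 'I_n -> T) : Prop := QuadraticPresentation {
  qp_deg : forall i, cg_deg 1 (x i);
  qp_rel_deg : forall i, cg_deg 1 (l i);
  qp_gen : forall t, cg_aug t = 0 -> exists f : 'I_n -> T, t = \sum_i f i * x i;
  qp_rel : \sum_i l i * x i = 0;
  qp_syz : forall f : 'I_n -> T, \sum_i f i * x i = 0 ->
    exists s, forall i, f i = s * l i;
  qp_free : forall c : 'I_n -> k, \sum_i c i *: l i = 0 -> forall i, c i = 0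
}.

Section LinearResolution.
Variables (k : fieldType) (T : cgAlgType k).
Variables (P : resolution (trivial_module T)) (gr : forall i, int -> set (P i)).
Hypothesis hgr : graded_resolution gr.
Variable B : forall i, set (P i).
Arguments B : clear implicits.
Arguments gr : clear implicits.
Hypotheses (hB : forall i, is_basis (B i)) (B_deg : forall i, B i `<=` gr i i%:Z).

Lemma res_d_coord i (b : P i.+1) c : B i.+1 b ->
  cg_deg 1 (fcoord (hB i) c (res_d P i b) : T).
Proof.
move=> hb; apply: (homogeneous_coord (gres_mod hgr i) (hB i) (@B_deg i)).
by apply: (gres_d hgr); have := B_deg hb; rewrite -intS.
Qed.

Lemma linear_aug_eq0 i (M : lmodType T) (B' : set M) (hB' : is_basis B')
    (f : {linear P i -> M}) c :
  (forall b, B i b -> cg_aug (fcoord hB' c (f b) : T) = 0) ->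
  forall x, cg_aug (fcoord hB' c (f x) : T) = 0.
Proof.
move=> h x; have [s [us sB ->]] := basis_expansion (hB i) x.
rewrite !linear_sum cg_aug_sum big_seq big1 // => b /sB /h e.
by rewrite !linearZ_LR /= cg_augM e mulr0.
Qed.

Lemma res_minimal i (x : P i.+1) c :
  cg_aug (fcoord (hB i) c (res_d P i x) : T) = 0.
Proof. by apply: linear_aug_eq0 => b /res_d_coord h; apply: cg_aug_deg (h c). Qed.

(** Graded Nakayama: the homotopy gives an endomorphism [E] of [P n] with values
    in [T_+ P n] that fixes every boundary [z], so the coordinates of [z] have
    arbitrarily high order. *)
Lemma res_d_eq0 n (y : P n.+1) : pd_le (trivial_module T) n -> res_d P n y = 0.
Proof.
move=> /(pd_le_split P)[h hh]; set z := res_d P n y.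
have ez : res_d P n (h z) = z by exact: hh.
suff hz m : forall c, order_ge m (fcoord (hB n) c z : T).
  apply: (@fcoord_eq0 _ _ _ (hB n)) => c _; apply: order_ge_eq0 => m; exact: hz.
elim: m => [c //|m ih c].
have [s [us sB e]] := basis_expansion (hB n) z.
rewrite -ez {1}e !linear_sum; apply: order_ge_sum => b bs.
rewrite !linearZ_LR /=; apply: order_ge_mul; first exact: ih.
exact: res_minimal.
Qed.

(** Over a minimal resolution, coboundaries with values in [T] have their values
    in [T_+]. *)
Lemma coboundary_aug i (f : P i.+1 -> T^o) x :
  coboundary f -> cg_aug (f x : T) = 0.
Proof.
move=> [g [lg ->]].
have [s [us sB e]] := basis_expansion (hB i) (res_d P i x).
rewrite -[g _]/(linear_of lg _) e linear_sum cg_aug_sum big_seq big1 // => b bs.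
by rewrite linearZ_LR /= cg_augM res_minimal mul0r.
Qed.

Lemma finite_expansion i (s : seq (P i)) : uniq s ->
  (forall b, b \in s -> B i b) -> (forall b, B i b -> b \in s) ->
  forall y, y = \sum_(b <- s) (fcoord (hB i) b y : T) *: b.
Proof.
move=> us sB Bs y; apply/eqP; rewrite -subr_eq0; apply/eqP.
apply: (@fcoord_eq0 _ _ _ (hB i)) => b /Bs bs.
by rewrite raddfB /= fcoord_sum // bs subrr.
Qed.

Hypothesis d2_eq0 : forall y, res_d P 2 y = 0.
Hypothesis ext1 : ext_vanishes 1 (trivial_module T) T^o.
Variable l : int.
Hypothesis ext2 : ext_is_shifted_k T 2 l.

Lemma cocycle2 (f : {linear P 2 -> T^o}) : cocycle f.
Proof. by split=> [|y]; [exact: linearP | rewrite d2_eq0 linear0]. Qed.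

(** By minimality no boundary in [P 0] has a coordinate with nonzero constant
    term; but [a' e - a e'] would be one, for distinct basis elements [e], [e']
    with augmentations [a], [a']. *)
Lemma B0_singleton : exists e, [/\ B 0%N e, res_aug P e != 0 & forall y, B 0%N y -> y = e].
Proof.
have aug_neq0 e : B 0%N e -> res_aug P e != 0.
  move=> Be; apply/eqP => /res_exact0[y ey].
  have := res_minimal y e; rewrite ey fcoord_basis // eqxx cg_aug1.
  by move/eqP; rewrite oner_eq0.
have [e Be] : exists e, B 0%N e.
  apply: contrapT => nB.
  have [x ex] := res_aug_surj P (1 : k).
  have x0 : x = 0 by apply: (@fcoord_eq0 _ _ _ (hB 0)) => b Bb; case: nB; exists b.
  by move/eqP: ex; rewrite x0 linear0 eq_sym (oner_eq0 k).
exists e; split=> [||e' Be'] //; first exact: aug_neq0.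
apply: contrapT => ne.
pose a : k := res_aug P e; pose a' : k := res_aug P e'.
have : res_aug P ((a'%:A : T) *: e - (a%:A : T) *: e') = 0.
  rewrite linearB /= !linearZ /= -/a -/a'.
  rewrite /GRing.scale /= !cg_aug_alg mulrC.
  by rewrite mulrN subrr.
move/res_exact0=> [y ey]; have := res_minimal y e; rewrite ey.
rewrite raddfB /= !linearZ_LR /= !fcoord_basis // eqxx.
have -> : (e' == e) = false by apply/eqP.
rewrite !scale_regular mulr1 oppr0 mulr0 addr0 cg_aug_alg => /eqP.
by move: (aug_neq0 _ Be'); rewrite /a' => /negPf->.
Qed.

(** Every coordinate form of [P 2] is a cocycle.  Two of them would be
    proportional modulo coboundaries, as [Ext^2] is one-dimensional, whereas a
    nontrivial scalar combination takes nonzero scalar values, which no coboundary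
    does. *)
Lemma B2_singleton : exists r, B 2%N r /\ forall y, B 2%N y -> y = r.
Proof.
have [ev [evD evM ev0 _ [f1 [f1c _ ev1]]]] := ext2 hgr.
have [r Br] : exists r, B 2%N r.
  apply: contrapT => nB.
  suff /(ev0 _ f1c).2 : coboundary f1.
    by rewrite ev1 => /eqP; rewrite oner_eq0.
  exists (fun=> 0); split=> [a x y|x]; first by rewrite scaler0 addr0.
  have -> : x = 0 by apply: (@fcoord_eq0 _ _ _ (hB 2)) => b Bb; case: nB; exists b.
  exact: (linear0 (linear_of f1c.1)).
exists r; split=> // r' Br'; apply: contrapT => ne.
pose f := fcoord (hB 2) r; pose f' := fcoord (hB 2) r'.
pose a := ev f; pose a' := ev f'.
have cM (h : {linear P 2 -> T^o}) t : cocycle (fun x => (h x : T) * t : T^o).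
  split=> [c x y|y]; last by rewrite d2_eq0 linear0 mul0r.
  by rewrite linearP /= mulrDl !scale_regular mulrA.
pose g := ((fun x => (f x : T) * a'%:A : T^o) \+
           (fun x => (f' x : T) * (- a)%:A : T^o))%R.
have gc : cocycle g.
  have [[l1 z1] [l2 z2]] := (cM f a'%:A, cM f' (- a)%:A).
  split=> [c x y|y]; last by rewrite /g /= z1 z2 addr0.
  by rewrite /g /= l1 l2 scalerDr addrACA.
have evg : ev g = 0.
  rewrite /g evD ?evM //; try exact: cM; try exact: cocycle2.
  by rewrite !cg_aug_alg -/a -/a' mulrC mulrN subrr.
have a'0 : a' = 0.
  have := coboundary_aug r ((ev0 _ gc).1 evg).
  rewrite /g /= !fcoord_basis // eqxx.
  have -> : (r == r') = false by apply/eqP => /esym.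
  by rewrite mul1r mul0r addr0 cg_aug_alg.
have := coboundary_aug r' ((ev0 _ (cocycle2 f')).1 a'0).
by rewrite fcoord_basis // eqxx cg_aug1 => /eqP; rewrite oner_eq0.
Qed.

(** The vanishing of [Ext^1] bounds the rank of [P 1]: the relation involves
    every basis element of [P 1], with linearly independent coefficients. *)
Lemma linear_resolution_presentation :
  exists n (x l : 'I_n -> T), quadratic_presentation x l.
Proof.
have [e [Be aug_e B0]] := B0_singleton.
have [r [Br B2]] := B2_singleton.
have P0E y : y = (fcoord (hB 0) e y : T) *: e.
  rewrite [LHS](@finite_expansion 0 [:: e]) ?big_seq1 //.
    by move=> b; rewrite mem_seq1 => /eqP->.
  by move=> b /B0 ->; rewrite mem_head.
have P2E y : y = (fcoord (hB 2) r y : T) *: r.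
  rewrite [LHS](@finite_expansion 2 [:: r]) ?big_seq1 //.
    by move=> b; rewrite mem_seq1 => /eqP->.
  by move=> b /B2 ->; rewrite mem_head.
pose X y : T := fcoord (hB 0) e (res_d P 0 y).
have [s [us sB er]] := basis_expansion (hB 1) (res_d P 1 r).
pose L b : T := fcoord (hB 1) b (res_d P 1 r).
(* A scalar function phi on the basis with sum phi(b) L(b) = 0 defines a
   1-cocycle, thus a coboundary, whose scalar values must vanish. *)
have L_free (phi : P 1 -> k) : \sum_(b <- s) phi b *: L b = 0 ->
    forall b, B 1%N b -> phi b = 0.
  move=> h0 b Bb.
  have [g hg] := linear_extension (hB 1) (fun b => (phi b)%:A : T^o).
  have gc : cocycle g.
    split=> [|y]; first exact: linearP.
    rewrite (P2E y) !linearZ_LR /= er linear_sum.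
    suff -> : \sum_(i <- s) g ((fcoord (hB 1) i (res_d P 1 r) : T) *: i) = 0.
      by rewrite scaler0.
    rewrite -[RHS]h0 !big_seq; apply: eq_bigr => c cs.
    by rewrite linearZ_LR /= hg; [exact: mulr_algr | exact: sB].
  have := coboundary_aug b (ext1 gc).
  by rewrite hg // cg_aug_alg.
have Bs b : B 1%N b -> b \in s.
  move=> Bb; apply: contraT => nbs.
  have := L_free (fun c => (c \notin s)%:R) _ b Bb; rewrite nbs.
  have h0 : \sum_(c <- s) (c \notin s)%:R *: L c = 0.
    by rewrite big_seq big1 // => c ->; rewrite scale0r.
  by move/(_ h0)/eqP; rewrite oner_eq0.
have P1E := finite_expansion us sB Bs.
exists (size s), (fun i => X (tnth (in_tuple s) i)),
  (fun i => L (tnth (in_tuple s) i)).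
have sumE (F : P 1 -> T) : \sum_(b <- s) F b = \sum_i F (tnth (in_tuple s) i).
  exact: (big_tnth _ _ s).
have XE y : X y = \sum_(b <- s) (fcoord (hB 1) b y : T) * X b.
  rewrite {1}/X {1}(P1E y) !linear_sum; apply: eq_bigr => b _.
  by rewrite !linearZ_LR.
split.
- by move=> i; apply: res_d_coord; apply: sB; apply: mem_tnth.
- by move=> i; apply: res_d_coord.
- move=> t t0.
  have [|y ey] := (res_exact0 (r := P) (t *: e)).1 _.
    by rewrite linearZ /= /GRing.scale /= t0 mul0r.
  exists (fun i => fcoord (hB 1) (tnth (in_tuple s) i) y).
  rewrite -(sumE (fun b => (fcoord (hB 1) b y : T) * X b)) -XE /X ey.
  by rewrite linearZ_LR /= fcoord_basis // eqxx; exact: esym (mulr1 t).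
- by rewrite -(sumE (fun b => L b * X b)) -XE /X res_dd linear0.
- move=> f hf.
  pose y : P 1 := \sum_i f i *: tnth (in_tuple s) i.
  have yc j : fcoord (hB 1) (tnth (in_tuple s) j) y = f j.
    rewrite /y linear_sum (bigD1 j) //= big1 => [|i ij].
      rewrite linearZ_LR /= fcoord_basis ?eqxx ?addr0; first exact: mulr1.
      by apply: sB; exact: mem_tnth.
    rewrite linearZ_LR /= fcoord_basis; last by apply: sB; exact: mem_tnth.
    have /negPf-> : tnth (in_tuple s) i != tnth (in_tuple s) j.
      by rewrite !(tnth_nth 0) nth_uniq.
    exact: mulr0.
  have y0 : res_d P 0 y = 0.
    rewrite (P0E (res_d P 0 y)) -/(X y) XE.
    rewrite (sumE (fun b => (fcoord (hB 1) b y : T) * X b)).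
    by under eq_bigr => i _ do rewrite yc; rewrite hf scale0r.
  have [z ez] := (res_exact y).1 y0.
  exists (fcoord (hB 2) r z) => i.
  by rewrite -yc -ez {1}(P2E z) !linearZ_LR.
- move=> c hc i.
  pose phi b : k := \sum_(j | tnth (in_tuple s) j == b) c j.
  have phiE j : phi (tnth (in_tuple s) j) = c j.
    rewrite /phi (big_pred1 j) // => m; rewrite !(tnth_nth 0) nth_uniq //.
  rewrite -phiE; apply: L_free; last by apply: sB; exact: mem_tnth.
  rewrite (sumE (fun b => phi b *: L b)) -[RHS]hc.
  by apply: eq_bigr => j _; rewrite phiE.
Qed.

End LinearResolution.

(** * Consequences of a one-relator quadratic presentation *)
Section Presentation.
Variables (k : fieldType) (T : cgAlgType k) (n : nat) (x l : 'I_n -> T).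
Hypothesis hq : quadratic_presentation x l.

Lemma qp_gen_deg m (t : T) : cg_deg m.+1 t ->
  exists f : 'I_n -> T, (forall i, cg_deg m (f i)) /\ t = \sum_i f i * x i.
Proof.
move=> ht; have [f ef] := qp_gen hq (cg_aug_deg ht).
exists (fun i => cg_comp m (f i)); split=> [i|]; first exact: cg_compP.
rewrite -(cg_comp_id ht) {1}ef cg_comp_sum; apply: eq_bigr => i _.
by rewrite -addn1 (cg_compMr _ _ (qp_deg hq i)).
Qed.

Lemma cg_deg0_scale (s t : T) : cg_deg 0 s -> s * t = cg_aug s *: t.
Proof. by move=> /cg_deg0[c ->]; rewrite cg_aug_alg mulr_algl. Qed.

Lemma qp_span (t : T) : cg_deg 1 t -> exists c : 'I_n -> k, t = \sum_i c i *: x i.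
Proof.
move=> /qp_gen_deg[f [hf ->]]; exists (fun i => cg_aug (f i)).
by apply: eq_bigr => i _; apply: cg_deg0_scale.
Qed.

Lemma qp_syz_deg m (f : 'I_n -> T) : (forall i, cg_deg m.+1 (f i)) ->
  \sum_i f i * x i = 0 -> exists s, cg_deg m s /\ forall i, f i = s * l i.
Proof.
move=> hf /(qp_syz hq)[s hs]; exists (cg_comp m s); split; first exact: cg_compP.
move=> i; rewrite -(cg_comp_id (hf i)) {1}hs -addn1.
by rewrite (cg_compMr _ _ (qp_rel_deg hq i)).
Qed.

Lemma qp_free_gen (c : 'I_n -> k) : \sum_i c i *: x i = 0 -> forall i, c i = 0.
Proof.
move=> hc i; have [|s hs] := qp_syz hq (f := fun i => (c i)%:A).
  by rewrite -[RHS]hc; apply: eq_bigr => j _; rewrite mulr_algl.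
rewrite -[c i](@cg_aug_alg k T) hs cg_augM.
by rewrite (cg_aug_deg (qp_rel_deg hq i)) mulr0.
Qed.

(** The [x i] generate [T] as an algebra. *)
Lemma qp_ind (S : set T) : S 1 ->
  (forall c a b, S a -> S b -> S (c *: a + b)) ->
  (forall t i, S t -> S (t * x i)) -> forall t, S t.
Proof.
move=> S1 Slin Smul; have S0 : S 0.
  by have := Slin (-1) _ _ S1 S1; rewrite scaleN1r addNr.
apply: cg_deg_ind => // m t ih /qp_gen_deg[f [hf ->]].
apply: (big_ind S) => // [a b Sa Sb|i _]; last exact/Smul/ih.
by rewrite -[a]scale1r; apply: Slin.
Qed.

Lemma free_matrix m (y : 'I_m -> T) : (forall i, cg_deg 1 (y i)) ->
  (forall c : 'I_m -> k, \sum_i c i *: y i = 0 -> forall i, c i = 0) ->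
  exists2 A : 'M[k]_(m, n), row_free A & forall i, y i = \sum_j A i j *: x j.
Proof.
move=> ydeg yfree.
have /choice[a ha] i : exists a : 'I_n -> k, y i = \sum_j a j *: x j.
  exact: qp_span (ydeg i).
exists (\matrix_(i, j) a i j) => [|i]; last first.
  by rewrite ha; apply: eq_bigr => j _; rewrite mxE.
apply: inj_row_free => v hv; apply/rowP => i; rewrite mxE.
apply: (yfree (fun i => v 0 i)).
under eq_bigr => j _ do rewrite ha scaler_sumr.
rewrite exchange_big big1 // => j _ /=.
under eq_bigr => e _ do rewrite scalerA.
rewrite -scaler_suml; have /rowP/(_ j) := hv; rewrite !mxE => hv'.
rewrite (_ : \sum_i0 _ = 0) ?scale0r // -[RHS]hv'.
by apply: eq_bigr => e _; rewrite mxE.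
Qed.

Lemma free_family_leq m (y : 'I_m -> T) : (forall i, cg_deg 1 (y i)) ->
  (forall c : 'I_m -> k, \sum_i c i *: y i = 0 -> forall i, c i = 0) ->
  (m <= n)%N.
Proof.
by move=> h /(free_matrix h)[A rA _]; rewrite -[m](eqP rA) rank_leq_col.
Qed.

(** A change of basis [x = A' y] turns the coefficients [l] of the relation into
    [A'^T l]. *)
Lemma quadratic_base_change (y : 'I_n -> T) : (forall i, cg_deg 1 (y i)) ->
  (forall c : 'I_n -> k, \sum_i c i *: y i = 0 -> forall i, c i = 0) ->
  exists l' : 'I_n -> T, quadratic_presentation y l'.
Proof.
move=> ydeg /(free_matrix ydeg)[A]; rewrite row_free_unit => uA yE.
pose A' := invmx A.
have AA' i j : \sum_e A i e * A' e j = (i == j)%:R.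
  by have /matrixP/(_ i j) := mulmxV uA; rewrite !mxE.
have A'A i j : \sum_e A' i e * A e j = (i == j)%:R.
  by have /matrixP/(_ i j) := mulVmx uA; rewrite !mxE.
have delta (V : lmodType k) (z : 'I_n -> V) i : \sum_j (i == j)%:R *: z j = z i.
  rewrite (bigD1 i) //= eqxx scale1r big1 ?addr0 // => j.
  by rewrite eq_sym => /negPf->; rewrite scale0r.
have swap (V : lmodType k) (C D : 'M[k]_n) (z : 'I_n -> V) i :
    \sum_j C i j *: \sum_e D j e *: z e = \sum_e (\sum_j C i j * D j e) *: z e.
  under eq_bigr => j _ do rewrite scaler_sumr.
  rewrite exchange_big; apply: eq_bigr => e _ /=; rewrite scaler_suml.
  by apply: eq_bigr => j _; rewrite scalerA.
have xE i : x i = \sum_j A' i j *: y j.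
  under eq_bigr => j _ do rewrite yE.
  rewrite swap -[LHS](delta T); apply: eq_bigr => e _.
  by rewrite A'A.
have move_sum (C : 'M[k]_n) (f z : 'I_n -> T) :
    \sum_i f i * (\sum_j C i j *: z j) = \sum_j (\sum_i C i j *: f i) * z j.
  under eq_bigr => i _ do rewrite mulr_sumr.
  rewrite exchange_big; apply: eq_bigr => j _ /=; rewrite mulr_suml.
  by apply: eq_bigr => i _; rewrite -scalerAr scalerAl.
have gen_y (f : 'I_n -> T) :
    \sum_i f i * x i = \sum_j (\sum_i A' i j *: f i) * y j.
  by rewrite -move_sum; apply: eq_bigr => i _; rewrite -xE.
exists (fun j => \sum_i A' i j *: l i); split=> //.
- by move=> j; apply: cg_deg_sum => i; apply: cg_degZ; exact: qp_rel_deg hq i.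
- move=> t /(qp_gen hq)[f ->].
  by exists (fun j => \sum_i A' i j *: f i); exact: gen_y.
- by rewrite -gen_y (qp_rel hq).
- move=> f; under eq_bigr => i _ do rewrite yE.
  rewrite move_sum => /(qp_syz hq)[s hs]; exists s => j.
  rewrite mulr_sumr; under eq_bigr => i _ do rewrite -scalerAr -hs.
  have := swap T A'^T A^T f j.
  rewrite (eq_bigr (fun i => A' i j *: \sum_i0 A i0 i *: f i0)) => [->|i _].
    rewrite -[LHS](delta T); apply: eq_bigr => e _; congr (_ *: _).
    rewrite eq_sym -AA'; apply: eq_bigr => i _.
    by rewrite !mxE mulrC.
  by rewrite mxE; congr (_ *: _); apply: eq_bigr => e _; rewrite mxE.
- move=> c hc.
  have hc' j : \sum_i A' j i * c i = 0.
    apply: (qp_free hq (c := fun j => \sum_i A' j i * c i)); rewrite -[RHS]hc.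
    under eq_bigr => i _ do rewrite scaler_suml.
    rewrite exchange_big; apply: eq_bigr => i _ /=; rewrite scaler_sumr.
    by apply: eq_bigr => e _; rewrite scalerA mulrC.
  move=> i; rewrite -[c i](delta k^o c i).
  under eq_bigr => j _ do rewrite -AA'.
  rewrite -(swap k^o A A' c i) big1 // => j _.
  rewrite (_ : \sum_e _ = 0) ?scaler0 //; exact: hc' j.
Qed.

(** Write [v] as the sum of the [c i x i].  If [t v = 0], the family [c i t] is a
    syzygy, [c i t = s l i].  A nonzero vector [a] orthogonal to [c] exists when
    [n > 1]; it gives [s w = 0], where [w], the sum of the [a i l i], is not zero
    by nondegeneracy, and where [s] has smaller degree than [t]. *)
Lemma qp_regular_deg (n_gt1 : (1 < n)%N) m (t v : T) : cg_deg m t -> cg_deg 1 v ->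
  v != 0 -> t * v = 0 -> t = 0.
Proof.
elim: m t v => [t v /cg_deg0[a ->] hv nv|m ih t v ht hv nv].
  by rewrite mulr_algl => /eqP; rewrite scaler_eq0 (negPf nv) orbF => /eqP->;
     rewrite scale0r.
have [c ec] := qp_span hv; rewrite {1}ec mulr_sumr.
under eq_bigr => i _ do rewrite -scalerAr scalerAl.
move=> h; have [s [hs es]] := qp_syz_deg (fun i => cg_degZ (c i) ht) h.
pose i0 : 'I_n := Ordinal (ltnW n_gt1); pose i1 : 'I_n := Ordinal n_gt1.
have [a [j aj] ha] : exists2 a : 'I_n -> k, (exists j, a j != 0) & \sum_i a i * c i = 0.
  have [c0|nc0] := eqVneq (c i0) 0.
    exists (fun i => (i == i0)%:R); first by exists i0; rewrite eqxx oner_eq0.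
    by rewrite big1 // => i _; case: eqP => [->|]; rewrite ?c0 ?mulr0 ?mul0r.
  exists (fun i => if i == i0 then c i1 else if i == i1 then - c i0 else 0).
    by exists i1; rewrite /= oppr_eq0.
  rewrite (bigD1 i0) //= (bigD1 i1) //= big1 ?addr0 => [|i /andP[/negPf-> /negPf->]].
    by rewrite mulNr mulrC subrr.
  by rewrite mul0r.
pose w := \sum_i a i *: l i.
have nw : w != 0 by apply: contraNneq aj => /(qp_free hq)->.
have hw : cg_deg 1 w.
  by apply: cg_deg_sum => i; apply: cg_degZ; exact: qp_rel_deg hq i.
have s0 : s = 0.
  apply: (ih s w) => //; rewrite mulr_sumr.
  under eq_bigr => i _ do rewrite -scalerAr -es scalerA.
  by rewrite -scaler_suml ha scale0r.
have [i ci] : exists i, c i != 0.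
  apply: contrapT => nc; case/eqP: nv; rewrite ec big1 // => i _.
  have [->|ci] := eqVneq (c i) 0; first by rewrite scale0r.
  by case: nc; exists i.
have := es i; rewrite s0 mul0r => /eqP.
by rewrite scaler_eq0 (negPf ci) => /eqP.
Qed.

Lemma qp_regular (n_gt1 : (1 < n)%N) (t v : T) : cg_deg 1 v ->
  v != 0 -> t * v = 0 -> t = 0.
Proof.
move=> hv nv tv; apply: cg_comps_eq0 => m.
apply: (qp_regular_deg n_gt1 (cg_compP m t) hv nv).
by rewrite -(cg_compMr _ _ hv) tv (cg_comp_id (cg_degB T _).1).
Qed.

Lemma qp_neq0 i : x i != 0.
Proof.
apply/eqP => xi; have := @qp_free_gen (fun j => (j == i)%:R) _ i.
rewrite eqxx big1 => [/(_ erefl)/eqP|j _]; first by rewrite oner_eq0.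
by case: eqP => [->|_]; rewrite ?xi ?scaler0 ?scale0r.
Qed.

Lemma qp_rel_neq0 i : l i != 0.
Proof.
apply/eqP => xi; have := @qp_free _ _ _ _ _ hq (fun j => (j == i)%:R) _ i.
rewrite eqxx big1 => [/(_ erefl)/eqP|j _]; first by rewrite oner_eq0.
by case: eqP => [->|_]; rewrite ?xi ?scaler0 ?scale0r.
Qed.

(** A syzygy between [x i0] and [x i1] only is a multiple [s l] of the relation
    with [s l i2 = 0]; then [s = 0] by regularity, and [T x i0 + T x i1] is direct.
    So the elements [x i0 x i1^j] generate free left submodules in direct sum. *)
Lemma noetherian_quadratic_leq2 : left_noetherian T -> (n <= 2)%N.
Proof.
move=> noeth; rewrite leqNgt; apply/negP => n_gt2.
have n_gt1 := ltnW n_gt2.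
pose i0 : 'I_n := Ordinal (ltnW n_gt1); pose i1 : 'I_n := Ordinal n_gt1.
pose i2 : 'I_n := Ordinal n_gt2.
have direct t0 t1 : t0 * x i0 + t1 * x i1 = 0 -> t0 = 0 /\ t1 = 0.
  pose f i := if i == i0 then t0 else if i == i1 then t1 else 0.
  move=> h; have [|s hs] := qp_syz hq (f := f).
    rewrite (bigD1 i0) //= (bigD1 i1) //= big1 ?addr0 => [|i /andP[/negPf n0 /negPf n1]].
      by rewrite /f eqxx.
    by rewrite /f n0 n1 mul0r.
  have s0 : s = 0.
    apply: (qp_regular n_gt1 (qp_rel_deg hq i2) (qp_rel_neq0 i2)).
    by rewrite -hs.
  by have := hs i0; have := hs i1; rewrite /f /= s0 !mul0r.
have indep m : forall f : nat -> T, \sum_(j < m) f j * (x i0 * x i1 ^+ j) = 0 ->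
    forall j, (j < m)%N -> f j = 0.
  elim: m => [//|m ih] f.
  rewrite big_ord_recl /= expr0 mulr1.
  under eq_bigr => j _ do rewrite exprSr !mulrA.
  rewrite -mulr_suml => /direct[f0]; under eq_bigr => j _ do rewrite -mulrA.
  by move=> /(ih (fun j => f j.+1)) h [|j] //= jm; apply: h.
pose I m : set T := [set t | exists f : nat -> T,
  t = \sum_(j < m) f j * (x i0 * x i1 ^+ j)].
have [m|m|N hN] := noeth I.
- split.
  + by exists (fun=> 0); rewrite big1 // => j _; rewrite mul0r.
  + move=> _ _ [f ->] [g ->]; exists (fun j => f j + g j).
    by rewrite -big_split; apply: eq_bigr => j _; rewrite mulrDl.
  + move=> a _ [f ->]; exists (fun j => a * f j).
    by rewrite mulr_sumr; apply: eq_bigr => j _; exact: mulrA.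
- move=> _ [f ->]; exists (fun j => if (j < m)%N then f j else 0).
  rewrite big_ord_recr /= ltnn mul0r addr0.
  by apply: eq_bigr => j _; rewrite ltn_ord.
have : I N.+1 (x i0 * x i1 ^+ N).
  exists (fun j => if j == N then 1 else 0).
  rewrite big_ord_recr /= eqxx mul1r big1 ?add0r // => j _.
  by rewrite ltn_eqF // mul0r.
rewrite hN // => -[f ef].
have := indep N.+1 (fun j => if j == N then -1 else f j) _ N (ltnSn N).
rewrite eqxx big_ord_recr /= eqxx mulN1r ef.
rewrite (eq_bigr (fun j : 'I_N => f j * (x i0 * x i1 ^+ j))) => [|j _].
  by rewrite subrr => /(_ erefl)/eqP; rewrite oppr_eq0 oner_eq0.
by rewrite ltn_eqF.
Qed.

End Presentation.

Definition pair_fun (T : Type) (x y : T) (i : 'I_2) : T := if i == 0 then x else y.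

(** * Two generators, and derivations acting on them *)
Lemma sum_pair (V : nmodType) (F : 'I_2 -> V) : \sum_i F i = F 0 + F 1.
Proof.
rewrite big_ord_recl big_ord_recl big_ord0 addr0.
by congr (F _ + F _); apply: val_inj.
Qed.

Section TwoGenerators.
Variables (k : fieldType) (T : cgAlgType k) (x y : T) (l : 'I_2 -> T).
Hypothesis hq : quadratic_presentation (pair_fun x y) l.

Lemma pair_deg : cg_deg 1 x /\ cg_deg 1 y.
Proof. by have := (qp_deg hq 0, qp_deg hq 1) => -[]. Qed.

Lemma pair_span t : cg_deg 1 t -> exists a b, t = a *: x + b *: y.
Proof. by case/(qp_span hq) => c ->; exists (c 0), (c 1); rewrite sum_pair. Qed.

Lemma pair_free a b a' b' : a *: x + b *: y = a' *: x + b' *: y ->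
  a = a' /\ b = b'.
Proof.
move=> h; have := qp_free_gen hq (c := pair_fun (a - a') (b - b')).
rewrite sum_pair /pair_fun /= !scalerBl addrACA -opprD h subrr.
by move=> /(_ erefl) c; split; apply/eqP; rewrite -subr_eq0; apply/eqP;
  [exact: c 0 | exact: c 1].
Qed.

Lemma pair_syz t t' : t * x + t' * y = 0 -> exists s, t = s * l 0 /\ t' = s * l 1.
Proof.
move=> h; have [|s hs] := qp_syz hq (f := pair_fun t t').
  by rewrite sum_pair.
by exists s; split; [exact: hs 0 | exact: hs 1].
Qed.

Lemma pair_syz1 t t' : cg_deg 1 t -> cg_deg 1 t' -> t * x + t' * y = 0 ->
  exists s : k, t = s *: l 0 /\ t' = s *: l 1.
Proof.
move=> ht ht' h; have [i||s [hs es]] := qp_syz_deg hq (m := 0) (f := pair_fun t t').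
- by rewrite /pair_fun; case: ifP.
- by rewrite sum_pair.
exists (cg_aug s).
by rewrite -!cg_deg0_scale //; split; [exact: es 0 | exact: es 1].
Qed.

Lemma pair_rel : l 0 * x + l 1 * y = 0.
Proof. by have := qp_rel hq; rewrite sum_pair. Qed.

(** Let the relation be [alpha x x + gamma y x + beta x y + delta y y].  Its
    images under [D] and [E] are multiples [si] and [ta] of it.  As [D] sends
    [y y] to [x y + y x], both [x y] and [y x] to [x x], and [x x] to 0, it is
    nilpotent; so [si = 0], whence [delta = 0] and [gamma = - beta].  Then [beta] cannot
    vanish, since the relation is nondegenerate; so [ta] is the weight
    [2a + 1] of [x y - y x], and [alpha = 0] because [x x] has weight [2a + 2]. *)
Lemma derivations_commute (D E : {linear T -> T}) (a : k) :
  (forall s t, D (s * t) = D s * t + s * D t) ->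
  (forall s t, E (s * t) = E s * t + s * E t) ->
  D y = x -> D x = 0 -> E y = a *: y -> E x = (a + 1) *: x -> x * y = y * x.
Proof.
move=> DM EM Dy Dx Ey Ex; have [hx hy] := pair_deg.
have lin (b c : k) : cg_deg 1 (b *: x + c *: y).
  by have [_ h] := cg_deg_sub T 1; apply: h => //; exact: cg_degZ.
have [al [ga e0]] := pair_span (qp_rel_deg hq 0).
have [be [de e1]] := pair_span (qp_rel_deg hq 1).
have n0 := qp_rel_neq0 hq 0; have n1 := qp_rel_neq0 hq 1.
have rel := pair_rel.
have [si [s0 s1]] : exists s : k, (ga + be) *: x + de *: y = s *: l 0 /\
    de *: x + 0 *: y = s *: l 1.
  apply: pair_syz1; [exact: lin | exact: lin |].
  rewrite -[RHS](linear0 D) -rel linearD !DM Dx Dy mulr0 addr0 e0 e1.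
  rewrite !linearP !linearZ /= Dx Dy !scaler0 !add0r.
  rewrite scale0r addr0 [de *: x * y + _]addrC addrA -mulrDl addrA.
  by rewrite -scalerDl.

move: s0 s1; rewrite e0 e1 !scalerDr !scalerA.
move=> /pair_free[s0 s0'] /pair_free[s1 s1'].
have si0 : si = 0.
  apply/eqP; apply: contraT => nsi.
  have de0 : de = 0 by apply/eqP; move/esym/eqP: s1'; rewrite mulf_eq0 (negPf nsi).
  have ga0 : ga = 0.
    by apply/eqP; move/esym/eqP: s0'; rewrite de0 mulf_eq0 (negPf nsi).
  have be0 : be = 0.
    by apply/eqP; move/esym/eqP: s1; rewrite de0 mulf_eq0 (negPf nsi).
  by case/eqP: n1; rewrite e1 be0 de0 !scale0r addr0.
have de0 : de = 0 by rewrite s1 si0 mul0r.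
have ga_be : ga = - be by apply/eqP; rewrite -addr_eq0 s0 si0 mul0r.
have nbe : be != 0 by apply: contraNneq n1 => be0; rewrite e1 be0 de0 !scale0r addr0.
have [ta [t0 t1]] : exists s : k,
    (al * (a + 1 + (a + 1))) *: x + (ga * (a + (a + 1))) *: y = s *: l 0 /\
    (be * (a + 1 + a)) *: x + 0 *: y = s *: l 1.
  apply: pair_syz1; [exact: lin | exact: lin |].
  rewrite -[RHS](linear0 E) -rel linearD !EM Ex Ey e0 e1 de0.
  rewrite !linearP !linearZ /= Ex Ey !scale0r !addr0.
  congr (_ + _).
    by rewrite !mulrDl -!scalerAl -!scalerAr !scalerA [RHS]addrACA -!scalerDl -!mulrDr.

  by rewrite -!scalerAl -!scalerAr !scalerA -scalerDl -mulrDr.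

move: t0 t1; rewrite e0 e1 !scalerDr !scalerA de0 mulr0.
move=> /pair_free[t0 _] /pair_free[t1 _].
have eta : ta = a + 1 + a by apply: (mulIf nbe); rewrite -t1 mulrC.
have al0 : al = 0.
  move/eqP: t0; rewrite eta mulrC -subr_eq0 -mulrBl [a + 1 + (_ + _)]addrA.
  by rewrite [_ + 1 - _]addrC addKr mul1r => /eqP.
apply/eqP; rewrite -subr_eq0; apply: contraT => nc.
have := rel; rewrite e0 e1 al0 de0 ga_be !scale0r add0r addr0 -!scalerAl.
rewrite scaleNr addrC -scalerBr => /eqP.
by rewrite scaler_eq0 (negPf nbe) (negPf nc).
Qed.

End TwoGenerators.

(** * Primitive elements of Hopf algebras *)
Section Multilinear.
Variable k : fieldType.

Lemma linear_mulr (A : algType k) (a : A) : linear (fun v : A => v * a).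
Proof. by move=> c x y; rewrite mulrDl scalerAl. Qed.

Lemma linear_mull (A : algType k) (a : A) : linear (fun v : A => a * v).
Proof. by move=> c x y; rewrite mulrDr scalerAr. Qed.

Lemma linear_scale (V W : lmodType k) (f : V -> W) : linear f ->
  forall c x, f (c *: x) = c *: f x.
Proof. by move=> hf c x; exact: (linearZ_LR (linear_of hf)). Qed.

Lemma linear_comp (U V W : lmodType k) (f : V -> W) (g : U -> V) :
  linear f -> linear g -> linear (fun v => f (g v)).
Proof. by move=> hf hg c x y; rewrite hg hf. Qed.

Lemma linear_sum_fun (V W : lmodType k) (J : Type) (s : seq J) (f : J -> V -> W) :
  (forall j, linear (f j)) -> linear (fun v => \sum_(j <- s) f j v).
Proof.
move=> hf c x y; rewrite scaler_sumr -big_split.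
by apply: eq_bigr => j _; rewrite hf.
Qed.

Lemma bilinear_comp (V W V' W' Z : lmodType k) (b : V -> W -> Z)
    (f : V' -> V) (g : W' -> W) : bilinear_map b -> linear f -> linear g ->
  bilinear_map (fun v w => b (f v) (g w)).
Proof.
by move=> [b1 b2] hf hg; split=> [v|w]; [exact: linear_comp | exact: linear_comp (b2 _) hf].
Qed.

Lemma bilinear_sum (V W Z : lmodType k) (J : Type) (s : seq J)
    (b : J -> V -> W -> Z) : (forall j, bilinear_map (b j)) ->
  bilinear_map (fun v w => \sum_(j <- s) b j v w).
Proof. by move=> hb; split=> v; apply: linear_sum_fun => j; have [] := hb j. Qed.

Lemma bilinear_mul (A : algType k) (V W : lmodType k) (f : V -> A) (g : W -> A) :
  linear f -> linear g -> bilinear_map (fun v w => f v * g w).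
Proof.
move=> hf hg; split=> v; first exact: linear_comp (linear_mull _) hg.
exact: linear_comp (linear_mulr _) hf.
Qed.

End Multilinear.

Section HopfLemmas.
Variables (k : fieldType) (H : hopfAlgType k).

Lemma primitive_sum (u : H) (Z : lmodType k) (b : H -> H -> Z) :
  primitive u -> bilinear_map b ->
  \sum_(y <- comul u) b y.1 y.2 = b u 1 + b 1 u.
Proof. by move=> hu /hu ->; rewrite big_cons big_seq1. Qed.

Lemma comul_mul_sum (x y : H) (Z : lmodType k) (b : H -> H -> Z) :
  bilinear_map b -> \sum_(z <- comul (x * y)) b z.1 z.2 =
    \sum_(p <- comul x) \sum_(q <- comul y) b (p.1 * q.1) (p.2 * q.2).
Proof. by move=> /(comulM x y) ->; rewrite /tensor_mul big_allpairs_dep. Qed.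

Lemma comul_sum_linear (Z : lmodType k) (b : H -> H -> Z) : bilinear_map b ->
  linear (fun x : H => \sum_(z <- comul x) b z.1 z.2).
Proof.
move=> hb c x y; rewrite (comul_linear c x y hb) big_cat big_map scaler_sumr /=.
congr (_ + _); apply: eq_bigr => p _ /=.
exact: linear_scale (hb.2 p.2) _ _.
Qed.

(** In Sweedler notation, [L x_1 (x_2 S(x_3)) = L x 1]. *)
Lemma antipode_cancel (x : H) (Z : lmodType k) (L : H -> H -> Z) :
  bilinear_map L ->
  \sum_(y <- comul x) \sum_(z <- comul y.1) L z.1 (z.2 * antipode y.2) = L x 1.
Proof.
move=> hL; have [L1 L2] := hL.
have tri : trilinear_map (fun a b c => L a (b * antipode c)).
  split=> a b.
  - by apply: linear_comp => //; apply: linear_comp (linear_mull _) _; exact: linearP.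
  - by apply: linear_comp => //; exact: linear_mulr.
  - exact: L2.
have := comulA x tri; rewrite !big_allpairs_dep => -> /=.
transitivity (\sum_(y <- comul x) L ((counit y.2 : k) *: y.1) 1).
  apply: eq_bigr => y _.
  rewrite -[LHS](linear_sum (linear_of (L1 y.1))) antipoder.
  by rewrite /= (linear_scale (L1 _)) (linear_scale (L2 1)).
by rewrite -[LHS](linear_sum (linear_of (L2 1))) counitr.
Qed.

End HopfLemmas.

Section PrimitiveIdeal.
Variables (k : fieldType) (H : hopfAlgType k) (u : H).
Hypotheses (hu : primitive u) (hu0 : counit u = 0).

(** The two-sided ideal [H u H]. *)
Definition principal_ideal : set H :=
  [set x | exists s : seq (H * H), x = \sum_(p <- s) p.1 * u * p.2].

Lemma principal_ideal1 g h : principal_ideal (g * u * h).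
Proof. by exists [:: (g, h)]; rewrite big_seq1. Qed.

Lemma principal_ideal_lin c x y :
  principal_ideal x -> principal_ideal y -> principal_ideal (c *: x + y).
Proof.
move=> [s ->] [s' ->]; exists ([seq (c *: p.1, p.2) | p <- s] ++ s').
rewrite big_cat big_map scaler_sumr; congr (_ + _); apply: eq_bigr => p _ /=.
by rewrite !scalerAl.
Qed.

Lemma principal_ideal0 : principal_ideal 0.
Proof. by exists [::]; rewrite big_nil. Qed.

Lemma principal_ideal_sum (J : Type) (s : seq J) (f : J -> H) :
  (forall j, principal_ideal (f j)) -> principal_ideal (\sum_(j <- s) f j).
Proof.
move=> hf; apply: (big_ind principal_ideal) => //; first exact: principal_ideal0.
by move=> x y hx; rewrite -[x]scale1r; apply: principal_ideal_lin.
Qed.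

Lemma principal_ideal_mul a x :
  principal_ideal x -> principal_ideal (a * x) /\ principal_ideal (x * a).
Proof.
move=> [s ->]; rewrite mulr_sumr mulr_suml; split; apply: principal_ideal_sum => p.
  by rewrite !mulrA; exact: principal_ideal1.
by rewrite -mulrA; exact: principal_ideal1.
Qed.

Lemma comul_generator_sum (g h : H) (Z : lmodType k) (b : H -> H -> Z) :
  bilinear_map b -> \sum_(z <- comul (g * u * h)) b z.1 z.2 =
  \sum_(p <- comul g) \sum_(q <- comul h) b (p.1 * u * q.1) (p.2 * q.2) +
  \sum_(p <- comul g) \sum_(q <- comul h) b (p.1 * q.1) (p.2 * u * q.2).
Proof.
move=> hb; rewrite comul_mul_sum //.
pose b' v w := \sum_(q <- comul h) b (v * q.1) (w * q.2).
have hb' : bilinear_map b'.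
  by apply: bilinear_sum => q; apply: bilinear_comp; [ | exact: linear_mulr | exact: linear_mulr].
rewrite -/(b' _ _) (comul_mul_sum g u hb') -big_split; apply: eq_bigr => p _ /=.
rewrite (primitive_sum (b := fun v w => b' (p.1 * v) (p.2 * w)) hu).
  by rewrite !mulr1.
by apply: bilinear_comp; [ | exact: linear_mull | exact: linear_mull].
Qed.

(** The antipode axiom for [g u h] and the formula for its coproduct show that
    [F g h = S(g_1 u h_1) g_2 h_2] is the opposite of [S(g_1 h_1) g_2 u h_2],
    which is in the ideal.  And [S(g u h)] is recovered from [F] as
    [F g_1 h_1 S(h_2) S(g_2)]. *)
Lemma antipode_principal_ideal (g h : H) : principal_ideal (antipode (g * u * h)).
Proof.
pose F g h := \sum_(p <- comul g) \sum_(q <- comul h)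
  antipode (p.1 * u * q.1) * (p.2 * q.2).
have F_in g' h' : principal_ideal (F g' h').
  have := antipodel (g' * u * h').
  rewrite !rmorphM /= hu0 mulr0 mul0r scale0r.
  rewrite (comul_generator_sum g' h' (b := fun v w => antipode v * w)); last first.
    by apply: bilinear_mul; [exact: linearP | move=> c x y].
  move/eqP; rewrite addr_eq0 => /eqP; rewrite -/(F _ _) => ->.
  rewrite -[- _]addr0 -scaleN1r; apply: principal_ideal_lin; last exact: principal_ideal0.
  apply: principal_ideal_sum => p; apply: principal_ideal_sum => q.
  by rewrite !mulrA; exact: principal_ideal1.
suff -> : antipode (g * u * h) = \sum_(p <- comul g) \sum_(q <- comul h)
    F p.1 q.1 * (antipode q.2 * antipode p.2).
  apply: principal_ideal_sum => p; apply: principal_ideal_sum => q.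
  by have [_] := principal_ideal_mul (antipode q.2 * antipode p.2) (F_in p.1 q.1).
have lin_S (f : H -> H) : linear f -> linear (fun v => antipode (f v)).
  by apply: linear_comp; exact: linearP.
rewrite -[LHS]mulr1 -(antipode_cancel g (L := fun a m => antipode (a * u * h) * m)).
  apply: eq_bigr => p _.
  under [RHS]eq_bigr => q _ do rewrite /F mulr_suml.
  rewrite exchange_big; apply: eq_bigr => p' _ /=.
  pose L a m := antipode (p'.1 * u * a) * (p'.2 * m * antipode p.2).
  have hL : bilinear_map L.
    apply: bilinear_mul; first exact/lin_S/linear_mull.
    by apply: linear_comp (linear_mulr _) _; exact: linear_mull.
  transitivity (L h 1); first by rewrite /L mulr1.
  rewrite -(antipode_cancel h hL).
  apply: eq_bigr => q _; rewrite mulr_suml; apply: eq_bigr => q' _.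
  by rewrite /L !mulrA.
apply: bilinear_mul => //; apply: lin_S.
by apply: linear_comp (linear_mulr _) _; exact: linear_mulr.
Qed.

Lemma primitive_hopf_ideal : hopf_ideal principal_ideal.
Proof.
split.
- by split; [exact: principal_ideal0 | exact: principal_ideal_lin].
- exact: principal_ideal_mul.
- move=> _ [s ->].
  pose rep (r : H * H) : seq (H * H) :=
    [seq (p.1 * u * q.1, p.2 * q.2) | p <- comul r.1, q <- comul r.2] ++
    [seq (p.1 * q.1, p.2 * u * q.2) | p <- comul r.1, q <- comul r.2].
  exists (flatten [seq rep r | r <- s]).
    move=> Z b hb; rewrite big_flatten big_map /=.
    rewrite [LHS](linear_sum (linear_of (comul_sum_linear hb))) /=.
    apply: eq_bigr => r _; rewrite /rep big_cat !big_allpairs_dep /=.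
    exact: comul_generator_sum.
  move=> y /flattenP[_ /mapP[r _ ->]]; rewrite mem_cat.
  by case/orP=> /allpairsP[pq [_ _ ->]] /=; [left | right]; exact: principal_ideal1.
- move=> _ [s ->]; rewrite linear_sum big1 // => p _.
  by rewrite !rmorphM /= hu0 mulr0 mul0r.
- move=> _ [s ->]; rewrite linear_sum; apply: principal_ideal_sum => p.
  exact: antipode_principal_ideal.
Qed.

(** An element of [H u H] acts as a sum of composites through the action of
    [u]. *)
Lemma inner_faithful_primitive (T : algType k) (act : H -> T -> T) :
  module_algebra_action act -> inner_faithful act ->
  (forall t, act u t = 0) -> u = 0.
Proof.
move=> hact faithful u0.
have I0 : principal_ideal = [set 0].
  apply: faithful primitive_hopf_ideal _ => _ t [s ->].
  rewrite -[act _ t]/(linear_of (act_linearl hact t) _) linear_sum big1 // => p _ /=.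
  rewrite !(actM hact) u0; exact: (linear0 (linear_of (act_linearr hact p.1))).
have : principal_ideal u by exists [:: (1, 1)]; rewrite big_seq1 mul1r mulr1.
by rewrite I0.
Qed.

Lemma primitive_derivation (T : algType k) (act : H -> T -> T) :
  module_algebra_action act ->
  forall s t, act u (s * t) = act u s * t + s * act u t.
Proof.
move=> hact s t; rewrite (act_mul hact).
rewrite (primitive_sum (b := fun v w => act v s * act w t) hu) ?(act1 hact) //.
by apply: bilinear_mul; exact: act_linearl.
Qed.

End PrimitiveIdeal.

Lemma hopf_morphism_primitive (k : fieldType) (U H : hopfAlgType k)
    (f : {lrmorphism U -> H}) (x : U) :
  hopf_morphism f -> primitive x -> primitive (f x).
Proof.
move=> [hf _ _] hx Z b hb; rewrite (hf x Z b hb) big_map /=.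
rewrite (primitive_sum (b := fun v w => b (f v) (f w)) hx).
  by rewrite big_cons big_seq1 /= rmorph1.
by apply: bilinear_comp => //; exact: linearP.
Qed.

(** The matrix units [E_10] and [E_11] satisfy the relations of [U] when
    [p > 1], and the first one is not zero. *)
Lemma U_generator_neq0 (k : fieldType) (p : nat) (U : hopfAlgType k) (u w : U) :
  (1 < p)%N -> is_U p u w -> u != 0.
Proof.
move=> p1 [_ univ _ _ _]; apply/eqP => u0.
pose a : 'M[k]_2 := delta_mx 1 0; pose b : 'M[k]_2 := delta_mx 1 1.
have [|f [fu _ _]] := univ _ a b.
  have bb : b * b = b by exact: mul_delta_mx.
  split.
  - case: p p1 {univ} => [|[|p]] // _; rewrite !exprS mulrA.
    by rewrite (_ : a * a = 0) ?mul0r //; exact: mul_delta_mx_0.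
  - case: p p1 {univ} => // p _; elim: p => [|p ih]; first by rewrite expr1.
    by rewrite exprS ih.
  - rewrite (_ : b * a = a); last exact: mul_delta_mx.
    by rewrite (_ : a * b = 0) ?subr0 //; exact: mul_delta_mx_0.
have /matrixP/(_ 1 0) : a = 0 by rewrite -fu u0 linear0.
by rewrite !mxE eqxx => /eqP; rewrite oner_eq0.
Qed.

(** * Commuting generators: the polynomial ring *)
Section CommutingPresentation.
Variables (k : fieldType) (T : cgAlgType k) (x y : T) (l : 'I_2 -> T).
Hypothesis hq : quadratic_presentation (pair_fun x y) l.
Hypothesis xy : x * y = y * x.

(** The relation [y x - x y = 0] is a scalar multiple of the given one. *)
Lemma koszul_syzygy s t : s * x + t * y = 0 -> exists r, t = r * x.
Proof.
have [hx hy] := pair_deg hq.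
have [||c [ey ex]] := pair_syz1 hq (t := y) (t' := - x) hy.
- by rewrite -scaleN1r; exact: cg_degZ.
- by rewrite mulNr -xy subrr.
have x0 : x != 0 by have := qp_neq0 hq 0.
have c0 : c != 0.
  by apply: contraNneq x0 => c0; rewrite -oppr_eq0 ex c0 scale0r.
have l1 : l 1 = (- c^-1) *: x.
  by rewrite scaleNr -scalerN ex scalerA mulVf // scale1r.
move=> /(pair_syz hq)[r [_ ->]]; exists ((- c^-1) *: r).
by rewrite l1 -scalerAr scalerAl.
Qed.

(** The powers of [y] are linearly independent modulo [T x]: the augmentation
    kills the constant coefficient, and [koszul_syzygy] divides the rest by
    [y]. *)
Lemma powers_mod_x m (a : nat -> k) s :
  \sum_(j < m) a j *: y ^+ j = s * x -> forall j, (j < m)%N -> a j = 0.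
Proof.
have [hx hy] := pair_deg hq.
elim: m a s => [//|m ih] a s; rewrite big_ord_recl /= expr0.
under eq_bigr => j _ do rewrite exprSr scalerAl.
rewrite -mulr_suml => e.
have a0 : a 0%N = 0.
  have := congr1 (@cg_aug k T) e.
  rewrite cg_augD !cg_augM cg_aug_alg (cg_aug_deg hx) (cg_aug_deg hy).
  by rewrite !mulr0 addr0.
have [|r er] := @koszul_syzygy (- s) (\sum_(j < m) a j.+1 *: y ^+ j).
  by move: e; rewrite a0 scale0r add0r mulNr => ->; rewrite addNr.
by case=> [|j] //= jm; apply: (ih (fun j => a j.+1) r).
Qed.

(** The terms with [i = 0] have their sum in [T x], so their coefficients vanish;
    the other terms can then be divided by [x], which is regular. *)
Lemma monomials_free m n (c : nat -> nat -> k) :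
  \sum_(i < m) \sum_(j < n) c i j *: (y ^+ j * x ^+ i) = 0 ->
  forall i j, (i < m)%N -> (j < n)%N -> c i j = 0.
Proof.
have [hx hy] := pair_deg hq.
have x0 : x != 0 by have := qp_neq0 hq 0.
elim: m c => [//|m ih] c; rewrite big_ord_recl /=.
under [X in _ + X]eq_bigr => i _.
  under eq_bigr => j _ do rewrite exprSr mulrA scalerAl.
  rewrite -mulr_suml.
over.
rewrite -mulr_suml => /eqP; rewrite addr_eq0 -mulNr => /eqP.
under eq_bigr => j _ do rewrite expr0 mulr1.
move=> e; have c0 := powers_mod_x e.
have q0 : \sum_(i < m) \sum_(j < n) c i.+1 j *: (y ^+ j * x ^+ i) = 0.
  apply: (qp_regular hq _ hx x0) => //; apply/eqP.
  rewrite -oppr_eq0 -mulNr -e big1 // => j _.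
  by rewrite c0 // scale0r.
by case=> [|i] j im jn; [exact: c0 | exact: (ih (fun i => c i.+1))].
Qed.

(** [mmap] is multiplicative if the images of the variables are central. *)
Lemma pair_fun_commute i (t : T) : GRing.comm t (pair_fun x y i).
Proof.
suff [tx ty] : t * x = x * t /\ t * y = y * t by rewrite /pair_fun; case: ifP.
move: t; apply: (qp_ind hq (S := fun t : T => t * x = x * t /\ t * y = y * t)).
- by rewrite !mul1r !mulr1.
- move=> c a b [ax ay] [bx bY].
  by rewrite !mulrDl !mulrDr -!scalerAl -!scalerAr ax ay bx bY.
- move=> t j [tx ty]; rewrite /pair_fun; case: ifP => _.
    by rewrite !(mulrA _ t x) -tx -ty; split; rewrite // -!mulrA xy.
  by rewrite !(mulrA _ t y) -tx -ty; split; rewrite // -!mulrA xy.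
Qed.

Definition mpoly_eval : mpoly 2 k -> T := mmap (GRing.in_alg T) (pair_fun x y).

Lemma mpoly_evalE (q : mpoly 2 k) : mpoly_eval q =
  \sum_(m <- msupp q) mcoeff m q *: (y ^+ m 1 * x ^+ m 0).
Proof.
apply: eq_bigr => m _; rewrite /mmap1 big_ord_recl big_ord1 /= mulr_algl.
rewrite (_ : lift ord0 ord0 = 1); last exact: val_inj.
congr (_ *: _); rewrite /pair_fun /=.
by apply: commrX; apply: commr_sym; apply: commrX.
Qed.

Lemma mpoly_eval_linear : linear mpoly_eval.
Proof.
move=> c q r; rewrite /mpoly_eval -[LHS]/(mmap _ _ _).
have -> : mmap (GRing.in_alg T) (pair_fun x y) (c *: q + r) =
  mmap (GRing.in_alg T) (pair_fun x y) (c *: q) +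
  mmap (GRing.in_alg T) (pair_fun x y) r by exact: mmapD.
by rewrite mmapZ /= mulr_algl.
Qed.

Lemma mpoly_eval_monoid : monoid_morphism mpoly_eval.
Proof.
have [|q m m'|h1 h2] :=
    @commr_mmap_is_multiplicative 2 k T (pair_fun x y) (GRing.in_alg T).
- by move=> i t; exact: pair_fun_commute.
- by rewrite /GRing.comm /= mulr_algl mulr_algr.
by split.
Qed.

Lemma mpoly_eval_inj q : mpoly_eval q = 0 -> q = 0.
Proof.
(* The sum over the support of q is extended to all exponents below N in both
   variables, in order to apply [monomials_free]. *)
pose M (i j : nat) : multinom 2 := Multinom [tuple i; j].
have ME (m : multinom 2) : m = M (m 0) (m 1).
  apply/mnmP => i; rewrite /M multinomE.
  case: i => [[|[|i]] hi] //; rewrite (tnth_nth 0%N) /=;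
    by congr (m _); apply: val_inj.
pose N := msize q; pose t := [seq M i j | i <- iota 0 N, j <- iota 0 N].
have ut : uniq t.
  apply: allpairs_uniq; rewrite ?iota_uniq // => -[i j] [i' j'] _ _ /= e.
  by have [e0 e1] := (congr1 (fun m : multinom 2 => m 0) e,
                      congr1 (fun m : multinom 2 => m 1) e); congr (_, _).
have m_lt (m : multinom 2) e : m \in msupp q -> (m e < N)%N.
  by move=> /msize_mdeg_lt; apply: leq_ltn_trans; rewrite mdegE (bigD1 e) //= leq_addr.
have sub_t : {subset msupp q <= t}.
  move=> m mq; apply/allpairsP; exists (m 0, m 1).
  by rewrite !mem_iota /= !m_lt.
rewrite mpoly_evalE (big_uniq_extend _ (msupp_uniq q) ut sub_t).
rewrite (eq_bigr (fun m => mcoeff m q *: (y ^+ m 1 * x ^+ m 0))); last first.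
  move=> m _; case: ifPn => // /memN_msupp_eq0 ->; by rewrite scale0r.
have iotaE : iota 0 N = index_iota 0 N by rewrite /index_iota subn0.
rewrite big_allpairs_dep iotaE big_mkord.
under eq_bigr => i _.
  rewrite big_mkord.
over.
move=> /(@monomials_free N N (fun i j => mcoeff (M i j) q)) h.
apply/mpolyP => m; rewrite mcoeff0; apply/eqP; rewrite mcoeff_eq0; apply/negP => mq.
have := mq; rewrite mcoeff_msupp (ME m) h ?eqxx //; exact: m_lt.
Qed.

Lemma mpoly_eval_surj t : exists q, mpoly_eval q = t.
Proof.
have [eval1 evalM] := mpoly_eval_monoid.
apply: (qp_ind hq (S := fun t => exists q, mpoly_eval q = t)).
- by exists 1; rewrite eval1.
- by move=> c _ _ [q <-] [r <-]; exists (c *: q + r); exact: mpoly_eval_linear.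
- move=> _ i [q <-]; exists (q * mpolyX k (mnm1 i)).
  by rewrite evalM /mpoly_eval mmapX mmap1U.
Qed.

Lemma commuting_presentation_iso :
  exists f : {lrmorphism T -> mpoly 2 k}, bijective f.
Proof.
have /choice[f fK] := mpoly_eval_surj.
have [eval1 evalM] := mpoly_eval_monoid.
have inj q r : mpoly_eval q = mpoly_eval r -> q = r.
  move=> e; apply/eqP; rewrite -subr_eq0; apply/eqP/mpoly_eval_inj.
  by rewrite addrC -scaleN1r mpoly_eval_linear e scaleN1r addNr.
have f_lin : linear f.
  by move=> c a b; apply: inj; rewrite mpoly_eval_linear !fK.
have f_mul : monoid_morphism f.
  by split=> [|a b]; apply: inj; rewrite ?evalM ?eval1 !fK.
pose F : {lrmorphism T -> mpoly 2 k} := HB.pack f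
  (GRing.isLinear.Build k T (mpoly 2 k) *:%R f f_lin)
  (GRing.isMonoidMorphism.Build T (mpoly 2 k) f f_mul).
by exists F; exists mpoly_eval => [t|q]; [exact: fK | apply: inj; exact: fK].
Qed.

End CommutingPresentation.

(** * Actions of Hopf algebras containing U *)

Theorem proposition0p4 (k : fieldType) (p : nat) (hp : p \in [pchar k])
  (U : hopfAlgType k) (u w : U) (hU : is_U p u w)
  (H : hopfAlgType k) (iota : {lrmorphism U -> H})
  (iota_hopf : hopf_morphism iota) (iota_inj : injective iota)
  (T : cgAlgType k) (hnoeth : noetherian T) (hkoszul : koszul T)
  (hreg : AS_regular T 2)
  (act : H -> T -> T) (hact : module_algebra_action act)
  (hfaithful : inner_faithful act) (hhom : homogeneous_action act) :
  exists f : {lrmorphism T -> mpoly 2 k}, bijective f.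
Proof.
have p_gt1 : (1 < p)%N by apply: prime_gt1; exact: pcharf_prime hp.
have [[up wp wu] _ [pu pw] [cu cw] _] := hU.
have piu := hopf_morphism_primitive iota_hopf pu.
have piw := hopf_morphism_primitive iota_hopf pw.
have ciu : counit (iota u) = 0 by have [_ -> _] := iota_hopf.
have [D DE] : exists D : {linear T -> T}, forall t, D t = act (iota u) t.
  by exists (linear_of (act_linearr hact (iota u))).
have [E EE] : exists E : {linear T -> T}, forall t, E t = act (iota w) t.
  by exists (linear_of (act_linearr hact (iota w))).
have DM s t : D (s * t) = D s * t + s * D t.
  by rewrite !DE (primitive_derivation piu hact).
have EM s t : E (s * t) = E s * t + s * E t.
  by rewrite !EE (primitive_derivation piw hact).
have ED t : E (D t) = D (E t) + D t.
  rewrite !DE !EE -!(actM hact) -!rmorphM -[in LHS](subrK (u * w) (w * u)) wu.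
  rewrite addrC rmorphD -[act _ t]/(linear_of (act_linearl hact t) _).
  by rewrite linearD.
have D_deg n t : cg_deg n t -> cg_deg n (D t) by rewrite DE; exact: hhom.
have E_deg n t : cg_deg n t -> cg_deg n (E t) by rewrite EE; exact: hhom.
have iterD m t : iter m D t = act (iota u ^+ m) t.
  elim: m => [|m ih]; first by rewrite expr0 (act1 hact).
  by rewrite iterS ih DE exprS (actM hact).
have Dp t : iter p D t = 0.
  rewrite iterD -rmorphXn up rmorph0.
  exact: (linear0 (linear_of (act_linearl hact t))).
have [P [gr [hgr /(_ _)/cid2 hB]]] := hkoszul.
have ext1 : ext_vanishes 1 (trivial_module T) T^o.
  by case: (AS_ext_vanishes hreg (i := 1%N)).
have [r [ext2 _]] := AS_ext_top hreg.
pose B i := s2val (hB i).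
have d2 : forall z, res_d P 2 z = 0.
  move=> z; apply: (res_d_eq0 hgr (B := B) (fun i => s2valP (hB i)) (fun i => s2valP' (hB i))).
  by have [[gl _] _] := AS_gldim hreg; exact: gl.
have [n [x0 [l0 hq0]]] := linear_resolution_presentation hgr
  (fun i => s2valP (hB i)) (fun i => s2valP' (hB i)) d2 ext1 ext2.
(* If u killed T_1 it would kill T, and H u H would be a nonzero Hopf ideal that
   acts by zero. *)
have [v [hv Dv]] : exists v, cg_deg 1 v /\ D v != 0.
  apply: contrapT => nD.
  have /eqP := U_generator_neq0 p_gt1 hU; apply; apply: iota_inj; rewrite rmorph0.
  apply: (inner_faithful_primitive piu ciu hact hfaithful) => t.
  rewrite -DE; move: t.
  apply: (qp_ind hq0 (S := fun t => D t = 0)).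
  - by rewrite DE (act_one hact) ciu scale0r.
  - by move=> c a b Da Db; rewrite linearP Da Db scaler0 addr0.
  - move=> t i Dt; rewrite DM Dt mul0r add0r.
    have [->|Dx] := eqVneq (D (x0 i)) 0; first by rewrite mulr0.
    by case: nD; exists (x0 i); split=> //; exact: qp_deg hq0 i.
(* The last but one nonzero iterate of v under u. *)
have [y [hy Dy DDy]] : exists y, [/\ cg_deg 1 y, D y != 0 & D (D y) = 0].
  have ex : exists m, iter m D v == 0 by exists p; rewrite Dp.
  case: (ex_minnP ex) => -[|[|m]] /eqP vm min_m.
  - by case/eqP: Dv; rewrite -[v]/(iter 0 D v) vm linear0.
  - by case/eqP: Dv.
  exists (iter m D v); split=> //; first by elim: (m) => //= j; exact: D_deg.
  by apply/negP => h; have := min_m m.+1 h; rewrite ltnn.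
set x := D y in Dy DDy.
have hx : cg_deg 1 x by exact: D_deg.
have free z : D z = x -> forall c : 'I_2 -> k,
    \sum_i c i *: pair_fun x z i = 0 -> forall i, c i = 0.
  move=> Dz c; rewrite sum_pair /pair_fun /= => e.
  have c1 : c 1 = 0.
    have := congr1 D e; rewrite linear0 linearD !linearZ_LR /= Dz DDy scaler0 add0r.
    by move/eqP; rewrite scaler_eq0 (negPf Dy) orbF => /eqP.
  have c0 : c 0 = 0.
    by move/eqP: e; rewrite c1 scale0r addr0 scaler_eq0 (negPf Dy) orbF => /eqP.
  by case=> [[|[|i]] hi] //; [rewrite -c0|rewrite -c1]; congr c; exact: val_inj.
have pair_deg1 z : cg_deg 1 z -> forall i, cg_deg 1 (pair_fun x z i).
  by move=> hz i; rewrite /pair_fun; case: ifP.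
have n2 : n = 2.
  apply/eqP; rewrite eqn_leq (noetherian_quadratic_leq2 hq0 hnoeth.1).
  exact: (free_family_leq hq0 (pair_deg1 _ hy) (free y erefl)).
subst n.
have [l1 hq1] := quadratic_base_change hq0 (pair_deg1 _ hy) (free y erefl).
have [b [a Ey]] := pair_span hq1 (E_deg _ _ hy).
(* On the span of x and y, w is triangular with the distinct eigenvalues a + 1
   and a; the vector z is an eigenvector for a. *)
pose z := y - b *: x.
have hz : cg_deg 1 z by have [_ h] := cg_degB T 1; apply: h => //; exact: cg_degZ.
have Dz : D z = x by rewrite /z linearB linearZ_LR /= DDy scaler0 subr0.
have Ex : E x = (a + 1) *: x.
  by rewrite /x ED Ey linearD !linearZ_LR /= DDy scaler0 add0r scalerDl scale1r.
have Ez : E z = a *: z.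
  rewrite /z linearB linearZ_LR /= Ex Ey scalerBr !scalerA mulrDr mulr1 scalerDl.
  by rewrite [b * a]mulrC opprD [b *: x + _]addrC addrACA subrr addr0.
have [l hq] := quadratic_base_change hq0 (pair_deg1 _ hz) (free z Dz).
apply: (commuting_presentation_iso hq).
exact: (derivations_commute hq DM EM Dz DDy Ez Ex).
Qed.
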